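(* Let $x_{k,i}$ be generated by the D-PSGD algorithm with step length $\gamma>0$, weight matrix $W$ and number of iterations $K\ge 1$, as described in the context. Let $$D_1 := \frac12 - \frac{9\gamma^2L^2n}{(1-\sqrt{\rho})^2D_2},\qquad D_2 := 1-\frac{18\gamma^2}{(1-\sqrt{\rho})^2}nL^2.$$ Under Assumption 1 of the context, the following convergence rate holds for the D-PSGD algorithm: $$\frac1K\left(\frac{1-\gamma L}{2}\sum_{k=0}^{K-1}\mathbb{E}\left\|\frac{\partial f(X_k)\mathbf{1}_n}{n}\right\|^2 + D_1\sum_{k=0}^{K-1}\mathbb{E}\left\|\nabla f\left(\frac{X_k\mathbf{1}_n}{n}\right)\right\|^2\right)\le \frac{f(0)-f^*}{\gamma K}+\frac{\gamma L}{2n}\sigma^2+\frac{\gamma^2L^2n\sigma^2}{(1-\rho)D_2}+\frac{9\gamma^2L^2n\varsigma^2}{(1-\sqrt{\rho})^2D_2}.$$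
   Context: Problem: there are $n$ nodes; node $i$ has a distribution $\mathcal{D}_i$ and a loss $F_i(x;\xi)$, $x\in\mathbb{R}^N$, differentiable in $x$. Set $f_i(x):=\mathbb{E}_{\xi\sim\mathcal{D}_i}F_i(x;\xi)$ and $f(x):=\frac1n\sum_{i=1}^n f_i(x)$, to be minimized over $\mathbb{R}^N$; $f^*$ is the optimal (minimum) value of $f$. Stochastic gradients are unbiased: $\mathbb{E}_{\xi\sim\mathcal{D}_i}\nabla F_i(x;\xi)=\nabla f_i(x)$ for all $x$ and $i$ (gradients are in $x$). Weight matrix: $W\in\mathbb{R}^{n\times n}$ is symmetric and doubly stochastic ($W_{ij}\in[0,1]$ and $W_{ij}=W_{ji}$ for all $i,j$, and $\sum_jW_{ij}=1$ for all $i$). $\lambda_i(\cdot)$ denotes the $i$-th largest eigenvalue of a matrix. D-PSGD (decentralized parallel stochastic gradient descent) algorithm: start from $x_{0,i}=x_0$ for all nodes $i$. For $k=0,1,\dots,K-1$ each node $i$ draws $\xi_{k,i}\sim\mathcal{D}_i$ (independently across nodes and iterations) and sets $$x_{k+1,i}=\sum_{j=1}^nW_{ij}x_{k,j}-\gamma\nabla F_i(x_{k,i};\xi_{k,i}).$$ Write $X_k:=[x_{k,1}\ \cdots\ x_{k,n}]\in\mathbb{R}^{N\times n}$, $\partial F(X_k;\xi_k):=[\nabla F_1(x_{k,1};\xi_{k,1})\ \cdots\ \nabla F_n(x_{k,n};\xi_{k,n})]\in\mathbb{R}^{N\times n}$ and $\partial f(X_k):=[\nabla f_1(x_{k,1})\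 \cdots\ \nabla f_n(x_{k,n})]\in\mathbb{R}^{N\times n}$; thus $X_{k+1}=X_kW-\gamma\,\partial F(X_k;\xi_k)$. $\mathbf{1}_n\in\mathbb{R}^n$ is the all-ones column vector and $\|\cdot\|$ is the Euclidean norm of a vector. Assumption 1: 1. (Lipschitzian gradient) every $f_i$ has an $L$-Lipschitz gradient. 2. (Spectral gap) for the symmetric doubly stochastic matrix $W$, $\rho:=(\max\{|\lambda_2(W)|,|\lambda_n(W)|\})^2$ satisfies $\rho<1$. 3. (Bounded variance) $\mathbb{E}_{i\sim\mathcal{U}([n])}\mathbb{E}_{\xi\sim\mathcal{D}_i}\|\nabla F_i(x;\xi)-\nabla f(x)\|^2$ is bounded over all $x$, where $i$ is uniform on $\{1,\dots,n\}$; hence there are constants $\sigma,\varsigma$, which are the ones used in the claim, with $\mathbb{E}_{\xi\sim\mathcal{D}_i}\|\nabla F_i(x;\xi)-\nabla f_i(x)\|^2\le\sigma^2$ for all $i$ and $x$, and $\mathbb{E}_{i\sim\mathcal{U}([n])}\|\nabla f_i(x)-\nabla f(x)\|^2\le\varsigma^2$ for all $x$. 4. (Start from 0) $X_0=0$.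
   Formalization: The formal statement adds the assumption D_2 > 0: for D_2 = 0 the bound is undefined, and for D_2 < 0 it fails (e.g. n = 2, all W_ij = 1/2, F = 0, sigma = 1, varsigma = 0, gamma L = 1/5). *)

(* Defs.v *)
From HB Require Import structures.
From mathcomp Require Import all_boot all_order all_algebra.
From mathcomp Require Import all_classical all_reals all_analysis.

Set Implicit Arguments.
Unset Strict Implicit.
Unset Printing Implicit Defensive.

Import Order.TTheory GRing.Theory Num.Theory.
Import numFieldNormedType.Exports.

Local Open Scope classical_set_scope.
Local Open Scope ring_scope.

(* The library norm on matrices is the sup norm, so the Euclidean norm is
   defined separately; both induce the same notion of differentiability. *)
Definition enorm (R : realType) (N : nat) (x : 'cV[R]_N) : R :=
  Num.sqrt (\sum_i x i 0 ^+ 2).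

Definition grad (R : realType) (N : nat) (g : 'cV[R]_N -> R) (x : 'cV[R]_N) :
    'cV[R]_N :=
  \col_j 'D_(delta_mx j 0) g x.

Definition lipschitz_grad (R : realType) (N : nat) (L : R)
    (g : 'cV[R]_N -> R) : Prop :=
  (forall x, differentiable g x) /\
  (forall x y, enorm (grad g x - grad g y) <= L * enorm (x - y)).

(* Eigenvalues listed with algebraic multiplicity, in nonincreasing order.
   A sorted list of roots is unique when it exists, and it exists exactly when
   the characteristic polynomial splits over R, e.g. for symmetric A; otherwise
   the list is empty. *)
Definition eigenvalues (R : realType) (n : nat) (A : 'M[R]_n) : seq R :=
  xget [::] [set s : seq R | sorted >=%R s /\
                             char_poly A = \prod_(a <- s) ('X - a%:P)].

(* [lambda i A] is the i-th largest eigenvalue, with i starting from 1. It is 0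
   for i out of range, so that [rho] is 1 for the 1 x 1 matrix 1. *)
Definition lambda (R : realType) (n : nat) (i : nat) (A : 'M[R]_n) : R :=
  nth 0 (eigenvalues A) i.-1.

Definition rho (R : realType) (n : nat) (W : 'M[R]_n) : R :=
  Num.max `|lambda 2 W| `|lambda n W| ^+ 2.

Definition mutually_independent d d' (T : measurableType d)
    (T' : measurableType d') (R : realType) (P : probability T R)
    (I : finType) (X : I -> {RV P >-> T'}) : Prop :=
  forall (J : {set I}) (A : I -> set T'), (forall i, measurable (A i)) ->
  P (\bigcap_(i in [set` J]) (X i @^-1` A i)) =
  (\prod_(i in J) P (X i @^-1` A i))%E.

Section Problem.
Context d (Xi : measurableType d) (R : realType) (N n : nat).
Context (D : 'I_n -> probability Xi R) (F : 'I_n -> 'cV[R]_N -> Xi -> R).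

Definition local_loss (i : 'I_n) (x : 'cV[R]_N) : R := fine 'E_(D i)[F i x].

Definition loss (x : 'cV[R]_N) : R := n%:R^-1 * \sum_i local_loss i x.

Definition stoch_grad (i : 'I_n) (x : 'cV[R]_N) (z : Xi) : 'cV[R]_N :=
  grad (F i ^~ z) x.

Definition local_grads (X : 'M[R]_(N, n)) : 'M[R]_(N, n) :=
  \matrix_(a, i) grad (local_loss i) (col i X) a 0.

(* The iterates of all nodes, when node j uses the sample z k j at step k. *)
Fixpoint dpsgd (W : 'M[R]_n) (gamma : R) (x0 : 'cV[R]_N)
    (z : nat -> 'I_n -> Xi) (k : nat) : 'I_n -> 'cV[R]_N :=
  if k is k'.+1 then
    let x := dpsgd W gamma x0 z k' in
    fun i => \sum_j W i j *: x j - gamma *: stoch_grad i (x i) (z k' i)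
  else fun=> x0.

Definition dpsgd_mx (W : 'M[R]_n) (gamma : R) (x0 : 'cV[R]_N)
    (z : nat -> 'I_n -> Xi) (k : nat) : 'M[R]_(N, n) :=
  \matrix_(a, i) dpsgd W gamma x0 z k i a 0.

End Problem.

Definition average (R : realType) (N n : nat) (X : 'M[R]_(N, n)) : 'cV[R]_N :=
  n%:R^-1 *: (X *m const_mx 1).

(* Main.v *)
Require Import Defs.
From HB Require Import structures.
From mathcomp Require Import all_boot all_order all_algebra.
From mathcomp Require Import all_classical all_reals all_analysis.
From mathcomp Require Import measurable_realfun spectral sesquilinear complex.
From mathcomp Require Import ring lra.

Set Implicit Arguments.
Unset Strict Implicit.
Unset Printing Implicit Defensive.

Import Order.TTheory GRing.Theory Num.Theory.
Import numFieldNormedType.Exports.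

Local Open Scope classical_set_scope.
Local Open Scope ring_scope.

(** The loss at the averaged iterate is analysed by the usual descent argument,
    and the price of decentralization is the disagreement of the nodes, the sum
    over the nodes of their squared distances to the average.

    Because [W] is doubly stochastic, averaging over the nodes commutes with
    mixing, so the average moves by exactly [- gamma] times the averaged
    stochastic gradient ([xbarS]). Split every stochastic gradient into the
    local gradient plus a noise. The descent inequality for the [L]-smooth
    average loss, with the inner product of the gradient at the average and the
    averaged local gradient written by polarization, gives [descent_step]; the
    only bias left is the squared distance of these two gradients, at most
    [L ^+ 2 / n] times the disagreement ([gradient_bias]).

    The disagreement obeys a linear recursion. By the spectral theorem and the
    spectral gap, [W] contracts by [q := Num.sqrt (rho W)] the families of
    vectors with zero sum ([contracting_mix]), and Young's inequality with
    weights [q] and [1 - q] adds the spread of the local gradients at the cost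
    of a factor [(1 - q)^-1] ([young_mix]). That spread is in turn bounded by
    the disagreement and [varsigma] ([gradient_spread]). Since the nodes start
    in agreement, summing the recursion bounds the total expected disagreement
    ([expected_spread_sum]).

    Both inequalities hold for every outcome, with terms linear in the noise
    that vanish in expectation. The reason is [noise_orthogonal]: the noise of
    node [i] at step [k] is orthogonal to every square-integrable vector that
    depends on the samples other than [(k, i)] only. This covers the terms
    linear in the noise as well as the products of the noises of two nodes,
    which is how the averaged noise gets its variance [sigma ^+ 2 / n]. The
    lemma follows from Fubini's theorem, because the sample [(k, i)] is
    independent of the sigma-algebra generated by the others ([other_indep]).
    It requires the stochastic gradient to be jointly measurable in the point
    and in the sample, which holds because the loss is continuous in the point
    and measurable in the sample ([measurable_caratheodory],
    [measurable_grad]).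

    What remains is arithmetic with the constants ([rate_arithmetic]). *)

(** * The mixing matrix contracts the deviations from the mean *)

Lemma char_poly_conj_diag (C : numClosedFieldType) n (P : 'M[C]_n)
    (s : 'rV[C]_n) : P \in unitmx ->
  char_poly (invmx P *m diag_mx s *m P) = \prod_i ('X - (s 0 i)%:P).
Proof.
move=> uP; transitivity (char_poly (diag_mx s)); last first.
  rewrite char_poly_trig ?diag_mx_is_trig//.
  by apply: eq_bigr => i _; rewrite mxE eqxx.
rewrite /char_poly /char_poly_mx.
pose Q := map_mx polyC P; pose Q' := map_mx polyC (invmx P).
have QQ : Q' *m Q = 1%:M by rewrite -map_mxM mulVmx// map_mx1.
have -> : 'X%:M - map_mx polyC (invmx P *m diag_mx s *m P) =
    Q' *m ('X%:M - map_mx polyC (diag_mx s)) *m Q.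
  rewrite mulmxBr mulmxBl !map_mxM; congr (_ - _).
  by rewrite mul_mx_scalar -scalemxAl QQ scalemx1.
by rewrite !det_mulmx mulrAC -det_mulmx QQ det1 mul1r.
Qed.

Section RealSymmetric.
Context (R : realType) (n : nat) (W : 'M[R]_n).
Hypothesis W_sym : forall i j, W i j = W j i.

Let C : numClosedFieldType := complex R.
Let toC : {rmorphism R -> C} := real_complex R.

(** The unitary basis lives over the complex numbers because the spectral theorem
    for normal matrices does; the eigenvalues of a hermitian matrix are real, so
    they also factor the real characteristic polynomial. *)
Lemma real_symmetric_diagonalization :
  exists2 P : 'M[C]_n, P \is unitarymx & exists delta : 'rV[R]_n,
    map_mx toC W = invmx P *m diag_mx (map_mx toC delta) *m P /\
    char_poly W = \prod_i ('X - (delta 0 i)%:P).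
Proof.
have realC (x : R) : toC x \is Num.real by apply/complex_realP; exists x.
have hW : map_mx toC W \is hermsymmx.
  apply: realsym_hermsym; last by apply/mxOverP => i j; rewrite mxE.
  apply/is_hermitianmxP; rewrite expr0 scale1r; apply/matrixP => i j.
  by rewrite !mxE W_sym.
have /orthomx_spectralP eqW := hermitian_normalmx hW.
have rW := hermitian_spectral_diag_real hW.
exists (spectralmx (map_mx toC W)); first exact: spectral_unitarymx.
pose delta := map_mx (@complex.Re R) (spectral_diag (map_mx toC W)).
have dE : map_mx toC delta = spectral_diag (map_mx toC W).
  apply/matrixP => i j; rewrite !mxE.
  by apply: RRe_real; apply: (mxOverP rW).
exists delta; rewrite dE; split => //.
apply: (map_poly_inj toC).
rewrite map_char_poly eqW char_poly_conj_diag ?spectral_unit//.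
rewrite rmorph_prod/=; apply: eq_bigr => i _.
by rewrite rmorphB/= map_polyX map_polyC/= -dE mxE.
Qed.

End RealSymmetric.

(** A factorization of the characteristic polynomial over the reals, once sorted,
    shows that the list chosen by [eigenvalues] is not the default one, and
    unique factorization identifies its entries. *)
Lemma eigenvaluesP (R : realType) n (W : 'M[R]_n) (delta : 'rV[R]_n) :
  char_poly W = \prod_i ('X - (delta 0 i)%:P) ->
  sorted >=%R (eigenvalues W) /\
  perm_eq (eigenvalues W) [seq delta 0 i | i <- enum 'I_n].
Proof.
move=> cW; rewrite /eigenvalues.
have big_seq (r : seq R) : perm_eq r [seq delta 0 i | i <- enum 'I_n] ->
    char_poly W = \prod_(a <- r) ('X - a%:P).
  by move=> /(perm_big _)->; rewrite big_map big_enum/= cW.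
case: xgetP => [s _ [ss cs]|/(_ (sort >=%R [seq delta 0 i | i <- enum 'I_n]))].
  split => //; apply: prod_XsubC_eq; rewrite -cs; exact/big_seq.
case; split; first by apply: sort_sorted => x y; rewrite orbC le_total.
by apply/big_seq; rewrite perm_sort.
Qed.

(** In a sorted list every entry but the first lies between the last and the
    second one. *)
Lemma norm_eigenvalues_tail (R : realType) n (W : 'M[R]_n) (k : nat) :
  sorted >=%R (eigenvalues W) -> size (eigenvalues W) = n -> (0 < k < n)%N ->
  `|(eigenvalues W)`_k| <= Num.max `|lambda 2 W| `|lambda n W|.
Proof.
move=> ss sz /andP[k0 kn].
have n0 : (0 < n)%N by exact: leq_trans kn.
have mono := sorted_leq_nth
  (fun y x z (xy : x >= y) (yz : y >= z) => le_trans yz xy) (@lexx _ R) 0 ss.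
have hi : (eigenvalues W)`_k <= lambda 2 W.
  by apply: mono => //; rewrite inE sz//; exact: leq_ltn_trans kn.
have lo : lambda n W <= (eigenvalues W)`_k.
  by apply: mono; rewrite ?inE ?sz ?prednK// -ltnS prednK.
rewrite le_max; case: (lerP 0 (eigenvalues W)`_k) => [a0|/ltW a0].
  by rewrite ger0_norm// (le_trans hi)// ler_norm.
rewrite (_ : `|_| <= `|lambda n W|) ?orbT// ler0_norm//.
by rewrite lerNl (le_trans _ lo)// lerNl ler_normr lexx orbT.
Qed.

Section Contraction.
Local Open Scope sesquilinear_scope.
Context (R : realType) (n : nat) (W : 'M[R]_n).
Hypothesis W_sym : forall i j, W i j = W j i.
Hypothesis W_stochastic : forall i, \sum_j W i j = 1.
Hypothesis spectral_gap : rho W < 1.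

Let C : numClosedFieldType := complex R.
Let toC : {rmorphism R -> C} := real_complex R.
Let q := Num.max `|lambda 2 W| `|lambda n W|.

Lemma rho_sqrt : Num.sqrt (rho W) = q.
Proof. by rewrite /rho sqrtr_sqr ger0_norm// le_max normr_ge0. Qed.

Lemma rho_ge0 : 0 <= rho W. Proof. exact: sqr_ge0. Qed.

Lemma sqrt_rho_lt1 : Num.sqrt (rho W) < 1.
Proof. by rewrite -sqrtr1 ltr_sqrt. Qed.

Let sqnorm (v : 'rV[C]_n) := (v *m v ^t*) 0 0.

Let sqnormE v : sqnorm v = \sum_j `|v 0 j| ^+ 2.
Proof. by rewrite /sqnorm mxE; apply: eq_bigr => j _; rewrite !mxE normCK. Qed.

Let sqnorm_unitary (P : 'M[C]_n) v : P \is unitarymx ->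
  sqnorm (v *m P ^t*) = sqnorm v.
Proof.
move=> uP; rewrite /sqnorm trmx_mul map_mxM mulmxA.
by rewrite trmxCK mulmxKtV.
Qed.

Let sqnorm_real (v : 'rV[R]_n) : sqnorm (map_mx toC v) = toC (\sum_j v 0 j ^+ 2).
Proof.
rewrite sqnormE rmorph_sum/=; apply: eq_bigr => j _.
by rewrite mxE rmorphXn/= real_normK//; apply/complex_realP; exists (v 0 j).
Qed.

(** Since all the later eigenvalues are smaller than 1 in absolute value, the
    eigenvalue 1 of the all-ones vector is simple, and the eigenvalues other
    than this one are bounded by the square root of [rho W]. *)
Lemma simple_unit_eigenvalue (delta : 'rV[R]_n) i0 :
  char_poly W = \prod_i ('X - (delta 0 i)%:P) -> delta 0 i0 = 1 ->
  forall i, i != i0 -> `|delta 0 i| <= q.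
Proof.
move=> cW d1 i ii0.
have [ss pe] := eigenvaluesP cW.
have sz : size (eigenvalues W) = n.
  by rewrite (perm_size pe) size_map size_enum_ord.
have q1 : q < 1 by rewrite -rho_sqrt sqrt_rho_lt1.
have tail k : (0 < k < n)%N -> `|(eigenvalues W)`_k| <= q.
  exact: norm_eigenvalues_tail.
case: (eigenvalues W) sz tail pe => [|a s] /= sz tail pe.
  by have := ltn_ord i; rewrite -[X in (_ < X)%N]sz.
have sq b : b \in s -> `|b| <= q.
  move=> /(nthP 0)[k ks <-]; apply: (tail k.+1).
  by rewrite ltnS leq0n -sz ltnS.
have a1 : a = 1.
  have : 1 \in a :: s.
    by rewrite (perm_mem pe) -d1; apply: map_f; rewrite mem_enum.
  rewrite inE => /orP[/eqP//|/sq]; rewrite normr1 => /le_lt_trans/(_ q1).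
  by rewrite ltxx.
apply: sq; rewrite {}a1 in pe.
have pe' : perm_eq (1 :: s) (1 :: [seq delta 0 i | i <- rem i0 (enum 'I_n)]).
  apply: (perm_trans pe); rewrite -d1 -map_cons; apply: perm_map.
  by apply: perm_to_rem; rewrite mem_enum.
move: pe'; rewrite perm_cons => /perm_mem ->; apply: map_f.
by rewrite mem_rem_uniq ?enum_uniq// inE ii0 mem_enum.
Qed.

(** In an orthonormal eigenbasis the all-ones vector has only one nonzero
    coordinate, so a vector orthogonal to it has no component along the
    eigenvalue 1. *)
Lemma contracting_row (y : 'rV[R]_n) : \sum_j y 0 j = 0 ->
  \sum_j (y *m W) 0 j ^+ 2 <= rho W * \sum_j y 0 j ^+ 2.
Proof.
move=> y0.
have [P uP [delta [eqW cW]]] := real_symmetric_diagonalization W_sym.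
rewrite invmx_unitary// in eqW.
have q1 : q < 1 by rewrite -rho_sqrt sqrt_rho_lt1.
pose z := map_mx toC y *m P ^t*; pose u : 'rV[R]_n := const_mx 1.
pose w := map_mx toC u *m P ^t*.
have diagE v : map_mx toC (v *m W) *m P ^t* =
    map_mx toC v *m P ^t* *m diag_mx (map_mx toC delta).
  by rewrite map_mxM eqW !mulmxA mulmxtVK.
have zD i : (map_mx toC (y *m W) *m P ^t*) 0 i = z 0 i * toC (delta 0 i).
  by rewrite diagE -/z mul_mx_diag [LHS]mxE [X in _ * X = _]mxE.
have uW : u *m W = u.
  apply/rowP => j; rewrite !mxE -[RHS](W_stochastic j).
  by apply: eq_bigr => i _; rewrite mxE mul1r W_sym.
have wE : w *m diag_mx (map_mx toC delta) = w by rewrite /w -diagE uW.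
have wD i : w 0 i * toC (delta 0 i) = w 0 i.
  have := congr1 (fun M : 'rV_n => M 0 i) wE.
  by rewrite mul_mx_diag [X in X = _]mxE [X in _ * X = _]mxE.
have zw : \sum_i z 0 i * (w 0 i)^* = 0.
  transitivity ((z *m w ^t*) 0 0).
    by rewrite mxE; apply: eq_bigr => j _; rewrite !mxE.
  rewrite /z /w trmx_mul map_mxM trmxCK mulmxA mulmxKtV// mxE.
  rewrite -[RHS](rmorph0 toC) -y0 rmorph_sum/=; apply: eq_bigr => j _.
  by rewrite !mxE !rmorph1 mulr1.
(* The vector w of coordinates of the all-ones vector is nonzero, and it vanishes
   wherever the eigenvalue is not 1. *)
have key i : `|z 0 i * toC (delta 0 i)| ^+ 2 <= toC (q ^+ 2) * `|z 0 i| ^+ 2.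
  have [i0 wi0] : exists i0, w 0 i0 != 0.
    apply/not_existsP => w0; have := ltn_ord i; rewrite ltnNge => /negP; apply.
    have : sqnorm w = toC n%:R.
      rewrite sqnorm_unitary// sqnorm_real (eq_bigr (fun=> 1)) => [|j _].
        by rewrite sumr_const card_ord.
      by rewrite mxE expr1n.
    rewrite sqnormE big1 => [|j _]; last first.
      by have /negP := w0 j; rewrite negbK => /eqP ->; rewrite normr0 expr0n.
    move/esym/eqP; rewrite fmorph_eq0 pnatr_eq0 => /eqP nE.
    by rewrite [X in (X <= _)%N]nE.
  have d1 : delta 0 i0 = 1.
    have /mulfI : w 0 i0 != 0 by [].
    move/(_ (toC (delta 0 i0)) 1).
    by rewrite wD mulr1 => /(_ erefl)/(fmorph_inj _).
  have small := simple_unit_eigenvalue cW d1.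
  have [->|ii0] := eqVneq i i0.
    suff -> : z 0 i0 = 0 by rewrite mul0r normr0 expr0n/= mulr0.
    move: zw; rewrite (bigD1 i0)//= big1 ?addr0 => [|j ji0].
      by move/eqP; rewrite mulf_eq0 conjC_eq0 (negbTE wi0) orbF => /eqP.
    suff -> : w 0 j = 0 by rewrite conjC0 mulr0.
    apply/eqP/negPn/negP => wj0; have := small j ji0.
    have -> : delta 0 j = 1.
      by move/mulfI : wj0 => /(_ (toC (delta 0 j)) 1);
        rewrite wD mulr1 => /(_ erefl)/(fmorph_inj _).
    by rewrite normr1 leNgt q1.
  rewrite normrM exprMn mulrC ler_wpM2r ?exprn_ge0//.
  rewrite real_normK; last by apply/complex_realP; exists (delta 0 i).
  rewrite -rmorphXn/= lecR -[leLHS]real_normK ?num_real//.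
  by rewrite lerXn2r ?nnegrE//?small// (le_trans _ (small i ii0)).
suff : toC (\sum_j (y *m W) 0 j ^+ 2) <= toC (rho W * \sum_j y 0 j ^+ 2).
  by rewrite lecR.
rewrite rmorphM -!sqnorm_real -(sqnorm_unitary _ uP).
rewrite -[X in _ * X](sqnorm_unitary _ uP).
by rewrite !sqnormE mulr_sumr; apply: ler_sum => i _; rewrite zD; exact: key.
Qed.

End Contraction.

(** * Averages and spreads of the vectors held by the nodes *)

Section Dot.
Context (R : realType) (N : nat).
Implicit Types u v w : 'cV[R]_N.

Definition dot u v : R := \sum_a u a 0 * v a 0.

Lemma dotC u v : dot u v = dot v u.
Proof. by apply: eq_bigr => a _; rewrite mulrC. Qed.

Lemma dotDl u v w : dot (u + v) w = dot u w + dot v w.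
Proof. by rewrite -big_split/=; apply: eq_bigr => a _; rewrite mxE mulrDl. Qed.

Lemma dotZl c u v : dot (c *: u) v = c * dot u v.
Proof. by rewrite mulr_sumr; apply: eq_bigr => a _; rewrite mxE mulrA. Qed.

Lemma dotDr u v w : dot w (u + v) = dot w u + dot w v.
Proof. by rewrite !(dotC w) dotDl. Qed.

Lemma dotZr c u v : dot u (c *: v) = c * dot u v.
Proof. by rewrite !(dotC u) dotZl. Qed.

Lemma dot0r u : dot u 0 = 0.
Proof. by rewrite -[X in dot u X](scale0r u) dotZr mul0r. Qed.

Lemma dotNl u v : dot (- u) v = - dot u v.
Proof. by rewrite -scaleN1r dotZl mulN1r. Qed.

Lemma dotNr u v : dot u (- v) = - dot u v.
Proof. by rewrite -scaleN1r dotZr mulN1r. Qed.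

Lemma dot_sumr n (x : 'I_n -> 'cV[R]_N) u :
  dot u (\sum_i x i) = \sum_i dot u (x i).
Proof.
rewrite exchange_big/=; apply: eq_bigr => a _.
by rewrite summxE mulr_sumr.
Qed.

Lemma dot_ge0 u : 0 <= dot u u.
Proof. by apply: sumr_ge0 => a _; rewrite -expr2 sqr_ge0. Qed.

Lemma enorm_sqr u : enorm u ^+ 2 = dot u u.
Proof.
rewrite /enorm sqr_sqrtr; last by apply: sumr_ge0 => a _; rewrite sqr_ge0.
by apply: eq_bigr => a _; rewrite expr2.
Qed.

Lemma enorm_ge0 u : 0 <= enorm u. Proof. exact: sqrtr_ge0. Qed.

Lemma dotD_sqr u v : dot (u + v) (u + v) = dot u u + 2 * dot v u + dot v v.
Proof. by rewrite !(dotDl, dotDr) (dotC u v); ring. Qed.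

Lemma dotD_le u v : dot (u + v) (u + v) <= 2 * (dot u u + dot v v).
Proof.
have := dot_ge0 (u - v).
rewrite !(dotDl, dotDr, dotNl, dotNr) (dotC v u); lra.
Qed.

Lemma coord_sqr_le u a : u a 0 ^+ 2 <= dot u u.
Proof.
rewrite /dot (bigD1 a)//= -expr2 lerDl; apply: sumr_ge0 => b _.
by rewrite -expr2 sqr_ge0.
Qed.

End Dot.

Section Network.
Context (R : realType) (N n : nat).
Implicit Types x g e : 'I_n -> 'cV[R]_N.
Hypothesis n_gt0 : (0 < n)%N.

Definition mean x : 'cV[R]_N := n%:R^-1 *: \sum_i x i.

Definition deviation x i := x i - mean x.

Definition spread x : R := \sum_i dot (deviation x i) (deviation x i).

Let n_neq0 : n%:R != 0 :> R. Proof. by rewrite pnatr_eq0 -lt0n. Qed.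

Lemma meanD x g : mean (fun i => x i + g i) = mean x + mean g.
Proof. by rewrite /mean big_split/= scalerDr. Qed.

Lemma meanZ c x : mean (fun i => c *: x i) = c *: mean x.
Proof. by rewrite /mean -scaler_sumr !scalerA mulrC. Qed.

Lemma mean_cst u : mean (fun=> u) = u.
Proof.
by rewrite /mean sumr_const card_ord -[u *+ n]scaler_nat scalerA mulVf ?scale1r.
Qed.

Lemma sum_deviation x : \sum_i deviation x i = 0.
Proof.
rewrite big_split/= sumr_const card_ord -scaler_nat scalerN /mean scalerA mulfV//.
by rewrite scale1r subrr.
Qed.

Lemma spread_ge0 x : 0 <= spread x.
Proof. by apply: sumr_ge0 => i _; exact: dot_ge0. Qed.

(** The mean minimizes the sum of squared distances to a point. *)
Lemma spread_le x u : spread x <= \sum_i dot (x i - u) (x i - u).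
Proof.
have -> : \sum_i dot (x i - u) (x i - u) =
    spread x + n%:R * dot (mean x - u) (mean x - u).
  transitivity (\sum_i (dot (deviation x i) (deviation x i)
     + (dot (mean x - u) (mean x - u) + 2 * dot (mean x - u) (deviation x i)))).
    apply: eq_bigr => i _.
    rewrite [X in dot X X](_ : _ = deviation x i + (mean x - u)).
      by rewrite dotD_sqr; ring.
    by rewrite addrA subrK.
  rewrite !big_split/= sumr_const card_ord -mulr_sumr -dot_sumr sum_deviation.
  by rewrite dot0r mulr0 addr0 -[dot _ _ *+ n]mulr_natl.
by rewrite lerDl mulr_ge0// dot_ge0.
Qed.

(** Jensen's inequality for the squared norm. *)
Lemma dot_mean_le x : dot (mean x) (mean x) <= n%:R^-1 * \sum_i dot (x i) (x i).
Proof.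
rewrite ler_pdivlMl ?ltr0n//.
have := spread_ge0 x.
suff -> : spread x = \sum_i dot (x i) (x i) - n%:R * dot (mean x) (mean x) by lra.
transitivity (\sum_i
  (dot (x i) (x i) - 2 * dot (mean x) (x i) + dot (mean x) (mean x))).
  apply: eq_bigr => i _; rewrite /deviation !(dotDl, dotDr, dotNl, dotNr).
  by rewrite (dotC (x i) (mean x)); ring.
rewrite !big_split/= sumrN -mulr_sumr -dot_sumr sumr_const card_ord -mulr_natl.
rewrite [X in dot _ X](_ : _ = n%:R *: mean x); first by rewrite dotZr; ring.
by rewrite /mean scalerA mulfV ?scale1r.
Qed.

Context (W : 'M[R]_n).
Hypothesis W_sym : forall i j, W i j = W j i.
Hypothesis W_stochastic : forall i, \sum_j W i j = 1.
Hypothesis spectral_gap : rho W < 1.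
Let q := Num.sqrt (rho W).

Lemma mean_mix x : mean (fun i => \sum_j W i j *: x j) = mean x.
Proof.
rewrite /mean exchange_big/=; congr (_ *: _); apply: eq_bigr => j _.
rewrite -scaler_suml -[RHS]scale1r -(W_stochastic j); congr (_ *: _).
exact: eq_bigr.
Qed.

(** This is [contracting_row] applied to each coordinate separately. *)
Lemma contracting_mix x : \sum_i x i = 0 ->
  \sum_i dot (\sum_j W i j *: x j) (\sum_j W i j *: x j)
  <= q ^+ 2 * \sum_i dot (x i) (x i).
Proof.
move=> x0; rewrite sqr_sqrtr ?rho_ge0// /dot.
rewrite exchange_big/= [X in _ <= _ * X]exchange_big/=.
rewrite mulr_sumr; apply: ler_sum => a _.
pose y : 'rV[R]_n := \row_j x j a 0.
rewrite [X in X <= _](_ : _ = \sum_j (y *m W) 0 j ^+ 2).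
  rewrite [X in _ <= _ * X](_ : _ = \sum_j y 0 j ^+ 2).
    apply: contracting_row => //.
    under eq_bigr do rewrite mxE.
    by rewrite -summxE x0 mxE.
  by apply: eq_bigr => j _; rewrite mxE expr2.
apply: eq_bigr => i _; rewrite summxE mxE expr2.
by congr (_ * _); apply: eq_bigr => j _; rewrite !mxE mulrC W_sym.
Qed.

(** Convexity: [|q (y / q) + (1 - q) (g / (1 - q))|^2] is at most
    [|y|^2 / q + |g|^2 / (1 - q)], and [|y|^2] is at most [q^2 |x|^2] for the
    mixture [y] of [x]. *)
Lemma young_mix x g : \sum_i x i = 0 ->
  \sum_i dot (\sum_j W i j *: x j + g i) (\sum_j W i j *: x j + g i)
  <= q * \sum_i dot (x i) (x i) + (1 - q)^-1 * \sum_i dot (g i) (g i).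
Proof.
move=> x0; have := contracting_mix x0.
set y := fun i => \sum_j W i j *: x j => yx.
have q1 : 0 < 1 - q by rewrite subr_gt0 sqrt_rho_lt1.
(* The weight 1 / q is not available for q = 0, but then the mixture vanishes. *)
have := sqrtr_ge0 (rho W); rewrite -/q le_eqVlt => /predU1P[q0|q0].
  have y0 i : dot (y i) (y i) = 0.
    apply/eqP; rewrite eq_le dot_ge0 andbT (le_trans _ (le_trans yx _))//.
      by rewrite (bigD1 i)//= lerDl sumr_ge0// => j _; exact: dot_ge0.
    by rewrite -q0 expr0n mul0r.
  rewrite -q0 mul0r add0r subr0 invr1 mul1r; apply: ler_sum => i _.
  rewrite le_eqVlt; apply/orP; left; apply/eqP; apply: eq_bigr => a _.
  have : y i a 0 = 0.
    by apply/eqP; rewrite -sqrf_eq0 eq_le sqr_ge0 andbT -(y0 i) coord_sqr_le.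
  by rewrite mxE -/(y i) => ->; rewrite add0r.
apply: (@le_trans _ _ (\sum_i
  (q^-1 * dot (y i) (y i) + (1 - q)^-1 * dot (g i) (g i)))).
  apply: ler_sum => i _; rewrite -/(y i).
  have := dot_ge0 ((1 - q) *: y i - q *: g i).
  rewrite !(dotD_sqr, dotNl, dotNr, dotZl, dotZr) => h.
  (* The difference of the two sides is |(1 - q) y - q g|^2 / (q (1 - q)). *)
  rewrite -subr_ge0 (_ : _ - _ = (q * (1 - q))^-1 *
     ((1 - q) * ((1 - q) * dot (y i) (y i))
      + 2 * - (q * ((1 - q) * dot (g i) (y i)))
      - - (q * (q * dot (g i) (g i))))); last by field; rewrite !gt_eqF.
  by rewrite mulr_ge0 ?invr_ge0 ?mulr_ge0 ?(ltW q0) ?(ltW q1)//; lra.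
rewrite big_split/= -!mulr_sumr lerD2r ler_pdivrMl//.
by rewrite mulrA -expr2.
Qed.

(** The next deviation of node [i] from the average, were there no noise. *)
Definition mixed_drift (gamma : R) x g i :=
  \sum_j W i j *: deviation x j - gamma *: deviation g i.

(** The exact expansion of the new spread has the inner product of the drift with
    the deviation of the noise; as the drifts sum to zero, the mean of the noise
    may be dropped from it. *)
Lemma spread_step (gamma : R) x g e :
  spread (fun i => \sum_j W i j *: x j - gamma *: (g i + e i)) <=
  q * spread x + gamma ^+ 2 / (1 - q) * spread g
  - 2 * gamma * \sum_i dot (mixed_drift gamma x g i) (e i)
  + gamma ^+ 2 * \sum_i dot (e i) (e i).
Proof.
set x' := fun i => _.
have mx' : mean x' = mean x - gamma *: (mean g + mean e).
  rewrite /x' meanD mean_mix; congr (_ + _).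
  by rewrite -scaleNr -meanD -meanZ; congr mean; apply/funext => i; rewrite scaleNr.
pose u i := mixed_drift gamma x g i.
have devx' i : deviation x' i = u i - gamma *: deviation e i.
  rewrite /deviation mx' /x' /u /mixed_drift /deviation.
  have -> : \sum_j W i j *: (x j - mean x) = \sum_j W i j *: x j - mean x.
    under eq_bigr do rewrite scalerBr.
    by rewrite big_split/= sumrN -scaler_suml W_stochastic scale1r.
  by apply/colP => a; rewrite !mxE; ring.
have su : \sum_i u i = 0.
  rewrite big_split/= sumrN -scaler_sumr sum_deviation scaler0 subr0.
  rewrite exchange_big/= -[RHS](sum_deviation x); apply: eq_bigr => j _.
  rewrite -scaler_suml -[RHS]scale1r -(W_stochastic j); congr (_ *: _).
  exact: eq_bigr.
have -> : spread x' = \sum_i dot (u i) (u i) - 2 * gamma * \sum_i dot (u i) (e i)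
    + gamma ^+ 2 * spread e.
  transitivity (\sum_i (dot (u i) (u i) - 2 * gamma * dot (u i) (e i) +
      gamma ^+ 2 * dot (deviation e i) (deviation e i) +
      2 * gamma * dot (mean e) (u i))).
    apply: eq_bigr => i _; rewrite devx'.
    rewrite dotD_sqr !(dotNl, dotNr, dotZl, dotZr).
    have -> : dot (deviation e i) (u i) = dot (u i) (e i) - dot (mean e) (u i).
      by rewrite dotDl dotNl (dotC (e i)).
    by rewrite dotZl; ring.
  rewrite !big_split/= sumrN -!mulr_sumr -dot_sumr su.
  by rewrite dot0r mulr0 addr0.
have spread_e : spread e <= \sum_i dot (e i) (e i).
  rewrite (le_trans (spread_le e 0))//.
  by under eq_bigr do rewrite subr0.
have : \sum_i dot (u i) (u i) <= q * spread x + gamma ^+ 2 / (1 - q) * spread g.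
  have := young_mix (fun i => - gamma *: deviation g i) (sum_deviation x).
  rewrite [X in _ + _ * X](_ : _ = gamma ^+ 2 * spread g).
    rewrite -/(spread x) mulrA [_^-1 * _]mulrC.
    by under eq_bigr do rewrite scaleNr.
  by rewrite mulr_sumr; apply: eq_bigr => i _; rewrite dotZl dotZr; ring.
have : gamma ^+ 2 * spread e <= gamma ^+ 2 * \sum_i dot (e i) (e i).
  by rewrite ler_wpM2l ?sqr_ge0.
rewrite -/u; lra.
Qed.

End Network.

(** * Gradients and the descent inequality *)

(** A form of the Cauchy-Schwarz inequality: expand [|u - c v|^2 >= 0]. *)
Lemma dot_le_scale (R : realType) (N : nat) (c : R) (u v : 'cV[R]_N) : 0 <= c ->
  dot u u <= c ^+ 2 * dot v v -> dot u v <= c * dot v v.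
Proof.
rewrite le_eqVlt => /predU1P[<-|c0] uv.
  have u0 a : u a 0 = 0.
    apply/eqP; rewrite -sqrf_eq0 eq_le sqr_ge0 andbT (le_trans (coord_sqr_le u a))//.
    by rewrite (le_trans uv)// expr0n mul0r.
  by rewrite mul0r /dot big1// => a _; rewrite u0 mul0r.
rewrite -(ler_pM2l c0); have := dot_ge0 (u - c *: v).
rewrite dotD_sqr !(dotNl, dotNr, dotZl, dotZr) (dotC v u); lra.
Qed.

Section Gradient.
Context (R : realType) (N : nat).
Implicit Types (g : 'cV[R]_N -> R) (x y v : 'cV[R]_N).

Lemma cV_sum_delta v : v = \sum_j v j 0 *: delta_mx j 0.
Proof.
by rewrite {1}(matrix_sum_delta v); apply: eq_bigr => i _; rewrite big_ord1.
Qed.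

Lemma derive_dot g x v : differentiable g x -> 'D_v g x = dot (grad g x) v.
Proof.
move=> dg; rewrite deriveE// {1}(cV_sum_delta v) linear_sum/=.
by apply: eq_bigr => j _; rewrite linearZ/= mxE deriveE// mulrC.
Qed.

Lemma is_derive_line g x v (t : R) : differentiable g (t *: v + x) ->
  is_derive t 1 (fun s : R => g (s *: v + x)) (dot (grad g (t *: v + x)) v).
Proof.
move=> dg; have cv := @diff_derivable _ _ _ g (t *: v + x) v dg.
rewrite -(derive_dot v dg); move: cv; rewrite /derivable /derive => cv.
have quotientE : (fun h : R => h^-1 *:
    (((fun s : R => g (s *: v + x)) \o shift t) (h *: 1) - g (t *: v + x))) =
    (fun h : R => h^-1 *: (g (h *: v + (t *: v + x)) - g (t *: v + x))).
  by apply/funext => h /=; rewrite [_%:A]mulr1 scalerDl addrA.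
by apply: DeriveDef; rewrite /derivable /derive quotientE.
Qed.

Lemma lipschitz_grad_sqr (L : R) g x y : 0 <= L -> lipschitz_grad L g ->
  dot (grad g x - grad g y) (grad g x - grad g y) <= L ^+ 2 * dot (x - y) (x - y).
Proof.
move=> L0 [_ lg]; rewrite -!enorm_sqr -exprMn lerXn2r ?nnegrE ?enorm_ge0//.
by rewrite mulr_ge0 ?enorm_ge0.
Qed.

(** Along the segment from [x] to [y], the difference between [g] and the quadratic
    upper bound has nonpositive derivative, since the gradient is Lipschitz. *)
Lemma descent_inequality (L : R) g x y : 0 <= L -> lipschitz_grad L g ->
  g y <= g x + dot (grad g x) (y - x) + L / 2 * dot (y - x) (y - x).
Proof.
move=> L0 lg; set v := y - x.
pose A := dot (grad g x) v; pose B := dot v v.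
pose phi : R -> R := fun s => g (s *: v + x).
pose psi : R -> R := phi - (A \*: (@id R)) - ((L / 2 * B) \*: (@id R ^+ 2)).
pose dpsi (t : R) := dot (grad g (t *: v + x)) v - A - L * B * t.
have dpsiP (t : R) : is_derive t 1 psi (dpsi t).
  have dphi := is_derive_line (lg.1 (t *: v + x)).
  have dX : is_derive t 1 (@id R ^+ 2) (2 * t).
    by apply: is_derive_eq; rewrite expr1 [_%:A]mulr1 mulr_natl.
  apply: is_derive_eq.
  have E2 : L / 2 * B * (2 * t) = L * B * t by field.
  by rewrite /dpsi [A%:A]mulr1 -E2.
have [|c cI] := @MVT R psi dpsi 0 1 ltr01 (fun t _ => dpsiP t).
  apply: derivable_within_continuous => t _; exact: ex_derive.
rewrite subr0 mulr1 => e.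
have : dpsi c <= 0.
  rewrite /dpsi subr_le0.
  move: cI; rewrite in_itv/= => /andP[c0 c1].
  have -> : dot (grad g (c *: v + x)) v - A = dot (grad g (c *: v + x) - grad g x) v.
    by rewrite dotDl dotNl.
  rewrite mulrAC; apply: dot_le_scale; first by rewrite mulr_ge0// ltW.
  rewrite (le_trans (lipschitz_grad_sqr _ _ L0 lg))// addrK dotZl dotZr exprMn.
  by rewrite -/B !mulrA.
rewrite -{}e /psi !fctE/= /phi scale1r scale0r add0r /v subrK -/v -/A -/B.
have E1 : (L / 2 * B)%:A = L / 2 * B := mulr1 _.
have E2 : A%:A = A := mulr1 _.
by rewrite expr1n expr0n/= !scaler0 E1 E2 !subr0 subr_le0 !lerBlDr addrAC.
Qed.

End Gradient.

Section Loss.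
Context d (Xi : measurableType d) (R : realType) (N n : nat).
Context (D : 'I_n -> probability Xi R) (F : 'I_n -> 'cV[R]_N -> Xi -> R).

Lemma lossE : loss D F = n%:R^-1 *: \sum_i local_loss D F i.
Proof. by apply/funext => x; rewrite /loss !fctE fct_sumE. Qed.

Lemma grad_loss x : (forall i, differentiable (local_loss D F i) x) ->
  grad (loss D F) x = mean (fun i => grad (local_loss D F i) x).
Proof.
move=> df; have dl i v : derivable (local_loss D F i) x v.
  exact/diff_derivable/df.
apply/colP => a; rewrite mxE lossE deriveZ; last exact: derivable_sum.
rewrite derive_sum// !mxE summxE; congr (_ * _).
by apply: eq_bigr => i _; rewrite mxE.
Qed.

Lemma lipschitz_grad_loss (L : R) : (0 < n)%N -> 0 <= L ->
  (forall i, lipschitz_grad L (local_loss D F i)) ->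
  lipschitz_grad L (loss D F).
Proof.
move=> n_gt0 L_ge0 f_lip; have df i x := (f_lip i).1 x.
split => [x|x y].
  by rewrite lossE; apply/differentiableZ/differentiable_sum => i; exact: df.
rewrite -(@ler_pXn2r _ 2)// ?nnegrE ?mulr_ge0 ?enorm_ge0// exprMn !enorm_sqr.
rewrite !grad_loss// -scaleN1r -meanZ -meanD.
rewrite (le_trans (dot_mean_le n_gt0 _))// ler_pdivrMl ?ltr0n//.
rewrite mulr_natl -[X in _ *+ X]card_ord -sumr_const; apply: ler_sum => i _.
by rewrite scaleN1r lipschitz_grad_sqr.
Qed.

End Loss.

(** * Measurability of random gradients at random points *)

Section Caratheodory.
Context d d' (T : measurableType d) (Xi : measurableType d') (R : realType)
  (N : nat).

(** Points with coordinates in a fixed countable set: a random point rounded to the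
    grid takes countably many values, so that measurability of a function of it
    reduces to measurability at fixed points. *)
Definition grid (m : nat) (c : 'cV[int]_N) : 'cV[R]_N :=
  \col_a ((c a 0)%:~R / m.+1%:R).

Definition grid_floor (m : nat) (x : 'cV[R]_N) : 'cV[int]_N :=
  \col_a Num.floor (x a 0 * m.+1%:R).

Lemma cvg_grid_floor (x : 'cV[R]_N) : grid m (grid_floor m x) @[m --> \oo] --> x.
Proof.
apply/cvg_ballP => e e0; near=> m; split => // a j; rewrite (ord1 j).
have m0 : 0 < m.+1%:R :> R by rewrite ltr0n.
rewrite /ball/= !mxE.
have /andP[l u] := floor_itv (x a 0 * m.+1%:R).
have -> : x a 0 - (Num.floor (x a 0 * m.+1%:R))%:~R / m.+1%:R =
   (x a 0 * m.+1%:R - (Num.floor (x a 0 * m.+1%:R))%:~R) / m.+1%:R.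
  by field; rewrite gt_eqF.
rewrite ger0_norm; last by rewrite divr_ge0 ?subr_ge0// ltW.
rewrite ltr_pdivrMr// (@lt_trans _ _ 1)//.
  by rewrite ltrBlDr addrC -(intrD _ _ 1).
rewrite -ltr_pdivrMl// mulr1; near: m.
exists (Num.bound e^-1) => // m/= bm.
rewrite (lt_le_trans (archi_boundP _)) ?invr_ge0 ?(ltW e0)// ler_nat.
exact: leqW.
Unshelve. all: by end_near. Qed.

(** Rounding the random point down to finer and finer grids, the composition is a
    limit, by continuity in the point, of functions that are measurable because
    each is glued from countably many measurable pieces. *)
Lemma measurable_caratheodory (F : 'cV[R]_N -> Xi -> R)
    (x : T -> 'cV[R]_N) (zeta : T -> Xi) :
  (forall z, continuous (F ^~ z)) -> (forall y, measurable_fun setT (F y)) ->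
  (forall a, measurable_fun setT (fun t => x t a 0)) ->
  measurable_fun setT zeta ->
  measurable_fun setT (fun t => F (x t) (zeta t)).
Proof.
move=> cF mF mx mz.
apply: (@measurable_fun_cvg _ _ _ _
  (fun m t => F (grid m (grid_floor m (x t))) (zeta t))).
  move=> m _ B mB; rewrite setTI.
  have -> : (fun t => F (grid m (grid_floor m (x t))) (zeta t)) @^-1` B =
    \bigcup_(c : 'cV[int]_N) ([set t | grid_floor m (x t) = c] `&`
        (F (grid m c) \o zeta) @^-1` B).
    apply/seteqP; split => [t tB|t [c _ [/= <-//]]].
    by exists (grid_floor m (x t)).
  apply: countable_bigcupT_measurable => [|c]; first exact: countableP.
  apply: measurableI; last first.
    rewrite -[X in measurable X]setTI; apply: (measurableT_comp (mF _) mz) => //.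
  have -> : [set t | grid_floor m (x t) = c] = \bigcap_(a in [set: 'I_N])
    ((fun t => x t a 0) @^-1`
      [set` `[(c a 0)%:~R / m.+1%:R, (c a 0 + 1)%:~R / m.+1%:R[%R]).
    have m0 : 0 < m.+1%:R :> R by rewrite ltr0n.
    apply/seteqP; split => [t /= <- a _|t /= h].
      rewrite /= in_itv/= !mxE ler_pdivrMr// ltr_pdivlMr//; exact: floor_itv.
    apply/colP => a; rewrite mxE; apply: floor_def.
    by have := h a I; rewrite /= in_itv/= ler_pdivrMr// ltr_pdivlMr.
  apply: fin_bigcap_measurable => // a _.
  by rewrite -[X in measurable X]setTI; apply: mx => //; exact: measurable_itv.
move=> t _; apply: (@cvg_comp _ _ _ (fun m => grid m (grid_floor m (x t)))
  (F ^~ (zeta t)) _ (nbhs (x t))); last exact: cF.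
exact: cvg_grid_floor.
Qed.

(** A partial derivative is the limit of difference quotients along [1 / (m + 1)],
    each measurable by [measurable_caratheodory]. *)
Lemma measurable_grad (F : 'cV[R]_N -> Xi -> R)
    (x : T -> 'cV[R]_N) (zeta : T -> Xi) (a : 'I_N) :
  (forall z y, differentiable (F ^~ z) y) -> (forall y, measurable_fun setT (F y)) ->
  (forall b, measurable_fun setT (fun t => x t b 0)) ->
  measurable_fun setT zeta ->
  measurable_fun setT (fun t => grad (F ^~ (zeta t)) (x t) a 0).
Proof.
move=> dF mF mx mz.
have cF z : continuous (F ^~ z) by move=> y; exact: differentiable_continuous.
pose h m : R := m.+1%:R^-1.
pose Q m t : R :=
  (h m)^-1 *: (F (h m *: delta_mx a 0 + x t) (zeta t) - F (x t) (zeta t)).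
apply: (@measurable_fun_cvg _ _ _ _ Q).
  move=> m; apply: measurable_funM => //; apply: measurable_funB.
    apply: (@measurable_caratheodory F (fun t => h m *: delta_mx a 0 + x t)) => // b.
    under eq_fun do rewrite mxE.
    exact: measurable_funD.
  exact: measurable_caratheodory.
move=> t _.
have := @diff_derivable _ _ _ (F ^~ (zeta t)) (x t) (delta_mx a 0) (dF _ _).
rewrite /derivable => cv; rewrite mxE /derive.
have /cvgr_dnbhsP cvD := cv.
apply: (cvD h); split; last exact: cvg_harmonic.
by move=> m; rewrite /h invr_neq0// pnatr_eq0.
Qed.

End Caratheodory.

(** * Independent samples and integration of one variable at a time *)

Section Freezing.
Local Open Scope ereal_scope.
Context d d1 d2 (Omega : measurableType d) (S : measurableType d1)
  (Xi : measurableType d2) (R : realType) (P : probability Omega R).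
Context (Y : {RV P >-> S}) (zeta : {RV P >-> Xi}).
Hypothesis indep : forall A B, measurable A -> measurable B ->
  P (Y @^-1` A `&` zeta @^-1` B) = P (Y @^-1` A) * P (zeta @^-1` B).

Let YZ w := (Y w, zeta w).

Let measurable_YZ : measurable_fun setT YZ.
Proof. exact: measurable_fun_pair. Qed.

Let joint : {RV P >-> (S * Xi)%type} :=
  HB.pack YZ (isMeasurableFun.Build _ _ _ _ YZ measurable_YZ).

Let joint_law C : measurable C ->
  (distribution P Y \x distribution P zeta) C = distribution P joint C.
Proof. by move=> mC; apply: product_measure_unique mC. Qed.

(** The joint law of independent variables is the product of their laws, so the
    first variable may be frozen while integrating over the second. *)
Lemma ge0_freezing (f : S * Xi -> \bar R) : measurable_fun setT f ->
  (forall u, 0 <= f u) ->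
  \int[P]_w f (Y w, zeta w) =
  \int[P]_w \int[distribution P zeta]_z f (Y w, z).
Proof.
move=> mf f0.
have mg :
    measurable_fun setT (fun y => \int[distribution P zeta]_z f (y, z)).
  exact: measurable_fun_fubini_tonelli_F.
rewrite -(ge0_integral_distribution Y mg); last first.
  by move=> y; exact: integral_ge0.
rewrite -(ge0_integral_distribution joint mf f0).
rewrite (eq_measure_integral (distribution P Y \x distribution P zeta)).
  by rewrite fubini_tonelli1.
by move=> A mA _; exact/esym/joint_law.
Qed.

Lemma freezing0 (f : S * Xi -> R) : measurable_fun setT f ->
  P.-integrable setT (fun w => (f (Y w, zeta w))%:E) ->
  (forall y, \int[distribution P zeta]_z (f (y, z))%:E = 0) ->
  \int[P]_w (f (Y w, zeta w))%:E = 0.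
Proof.
move=> mf fi f0.
have mf' : measurable_fun setT (EFin \o f) by exact/measurable_EFinP.
have fi' :
    (distribution P Y \x distribution P zeta).-integrable setT (EFin \o f).
  apply/integrableP; split => //.
  rewrite (eq_measure_integral (distribution P joint)); last first.
    by move=> A mA _; exact: joint_law.
  rewrite (ge0_integral_distribution joint)//; last exact: measurableT_comp.
  by case/integrableP : fi.
have := integral_distribution mf' (X := joint) fi.
rewrite (eq_measure_integral (distribution P Y \x distribution P zeta)); last first.
  by move=> A mA _; exact/esym/joint_law.
move=> <-; rewrite -integral12_prod_meas1//.
by rewrite integral0_eq// => y _; exact: f0.
Qed.

End Freezing.

Section OtherVariables.
Local Open Scope ereal_scope.
Context d d' (Omega : measurableType d) (Xi : measurableType d') (R : realType)
  (P : probability Omega R) (I : finType) (X : I -> {RV P >-> Xi}) (i0 : I).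
Hypothesis X_indep : mutually_independent X.

(** A generating family, closed under intersection, of the sigma-algebra of the
    variables other than [X i0]. *)
Definition other_cylinders : set (set Omega) :=
  [set C | exists2 A : I -> set Xi, (forall i, measurable (A i)) &
     C = \bigcap_(i in [set i | i != i0]) X i @^-1` A i].

Notation others := (g_sigma_algebraType other_cylinders).

Lemma measurable_preimage_var i (B : set Xi) : measurable B ->
  measurable (X i @^-1` B).
Proof. by move=> mB; rewrite -[X in measurable X]setTI; exact: measurable_funP. Qed.

Lemma other_cylinders_measurable : other_cylinders `<=` measurable.
Proof.
move=> _ [A mA ->]; apply: fin_bigcap_measurable => [|i _].
  exact: finite_finset.
exact: measurable_preimage_var.
Qed.

Lemma other_measurable_sub (A : set Omega) :
  measurable (A : set others) -> measurable A.
Proof.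
apply: smallest_sub; first exact: sigma_algebra_measurable.
exact: other_cylinders_measurable.
Qed.

Lemma measurable_other_id : measurable_fun setT (id : Omega -> others).
Proof. by move=> _ A mA; rewrite setTI; exact: other_measurable_sub. Qed.

(** The variables other than [X i0] are collected into the identity of [Omega] with
    the sigma-algebra of the target restricted to what they determine; being a
    function of them means being measurable for this sigma-algebra. *)
Definition other_id : {RV P >-> others} :=
  HB.pack (id : Omega -> others)
    (isMeasurableFun.Build _ _ _ _ (id : Omega -> others) measurable_other_id).

Lemma measurable_other_var i : i != i0 ->
  measurable_fun setT (X i : others -> Xi).
Proof.
move=> ii0 _ B mB; rewrite setTI; apply: sub_sigma_algebra.
exists (fun j => if j == i then B else setT) => [j|]; first by case: ifP.
apply/seteqP; split => [w Bw j _ /=|w /(_ i ii0)/=]; last by rewrite eqxx.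
by case: eqP => [->|].
Qed.

Lemma setI_closed_other_cylinders : setI_closed other_cylinders.
Proof.
move=> _ _ [A mA ->] [B mB ->]; exists (fun i => A i `&` B i).
  by move=> i; exact: measurableI.
by rewrite -bigcapI; apply: eq_bigcapr => i _; rewrite preimage_setI.
Qed.

(** For a fixed event of [X i0], both sides are finite measures in [A] that agree on
    the cylinders, hence on the sigma-algebra which these generate. *)
Lemma other_indep (A : set others) (B : set Xi) : measurable A ->
  measurable B ->
  P (other_id @^-1` A `&` X i0 @^-1` B) = P (other_id @^-1` A) * P (X i0 @^-1` B).
Proof.
move=> mA mB.
have mXB := measurable_preimage_var i0 mB.
have pE : P (X i0 @^-1` B) = (fine (P (X i0 @^-1` B)))%:E.
  by rewrite fineK// fin_num_measure.
have p0 : (0 <= fine (P (X i0 @^-1` B)))%R by rewrite fine_ge0.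
rewrite pE muleC.
change (mrestr P mXB A = mscale (NngNum p0) P A).
have subT : [set C | other_cylinders C /\ C `<=` setT] = other_cylinders.
  by apply/seteqP; split => [C []//|C].
apply: (@g_sigma_algebra_measure_unique_trace _ _ _ other_cylinders setT);
    rewrite ?subT//.
- exact: other_cylinders_measurable.
- exact: setI_closed_other_cylinders.
- by rewrite /= /mrestr /mscale/= setTI probability_setT mule1 -pE.
- move=> _ [C mC ->]; rewrite /= /mrestr /mscale/=.
  rewrite -pE muleC.
  pose C' j := if j == i0 then B else C j.
  have mC' j : measurable (C' j) by rewrite /C'; case: ifP.
  transitivity (P (\bigcap_(i in [set` [set: I]%SET]) (X i @^-1` C' i))).
    congr (P _); apply/seteqP; split => [w [Cw Bw] j _ /=|w h].
      by rewrite /C'; case: ifPn => [/eqP ->//|/Cw].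
    split => [j /= ji0|]; last first.
      by have := h i0; rewrite /C'/= eqxx finset.in_setT; apply.
    by have := h j; rewrite /C'/= finset.in_setT (negbTE ji0); apply.
  rewrite X_indep// (bigD1 i0)//= /C' eqxx muleC; congr (_ * _).
  transitivity (P (\bigcap_(i in [set` [set i | i != i0]%SET]) (X i @^-1` C i))).
    rewrite X_indep//; apply: congr_big => // i; first by rewrite !inE.
    by rewrite !inE => /negbTE ->.
  by congr (P _); apply/seteqP; split => w h j /= jP; apply: h => /=;
    rewrite ?inE// in jP *.
- rewrite /= /mrestr (le_lt_trans (probability_le1 _ _)) ?ltry//.
  exact: measurableI.
Qed.

End OtherVariables.

(** * Square-integrable random vectors *)

Section VectorMeasurability.
Context d (T : measurableType d) (R : realType) (N : nat).
Implicit Types x y : T -> 'cV[R]_N.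

Definition measurable_vec x :=
  forall a, measurable_fun setT (fun t => x t a 0).

Lemma measurable_vec_cst u : measurable_vec (cst u).
Proof. by move=> a; exact: measurable_cst. Qed.

Lemma measurable_vecD x y : measurable_vec x -> measurable_vec y ->
  measurable_vec (fun t => x t + y t).
Proof. by move=> mx my a; under eq_fun do rewrite mxE; exact: measurable_funD. Qed.

Lemma measurable_vecZ c x : measurable_vec x ->
  measurable_vec (fun t => c *: x t).
Proof. by move=> mx a; under eq_fun do rewrite mxE; exact: measurable_funM. Qed.

Lemma measurable_vecB x y : measurable_vec x -> measurable_vec y ->
  measurable_vec (fun t => x t - y t).
Proof. by move=> mx my a; under eq_fun do rewrite !mxE; exact: measurable_funB. Qed.

Lemma measurable_vec_sum n (x : 'I_n -> T -> 'cV[R]_N) :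
  (forall i, measurable_vec (x i)) -> measurable_vec (fun t => \sum_i x i t).
Proof.
move=> mx a; under eq_fun do rewrite summxE.
by apply: measurable_sum => i; exact: mx.
Qed.

Lemma measurable_vec_mean n (x : 'I_n -> T -> 'cV[R]_N) :
  (forall i, measurable_vec (x i)) -> measurable_vec (fun t => mean (x ^~ t)).
Proof. by move=> mx; apply/measurable_vecZ/measurable_vec_sum. Qed.

Lemma measurable_dot x y : measurable_vec x -> measurable_vec y ->
  measurable_fun setT (fun t => dot (x t) (y t)).
Proof. by move=> mx my; apply: measurable_sum => a; exact: measurable_funM. Qed.

(** This is [measurable_grad] for a loss that ignores the sample. *)
Lemma measurable_vec_grad (g : 'cV[R]_N -> R) x :
  (forall u, differentiable g u) -> measurable_vec x ->
  measurable_vec (fun t => grad g (x t)).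
Proof.
move=> dg mx a.
exact: (@measurable_grad _ _ T T R N (fun u _ => g u) x id a).
Qed.

End VectorMeasurability.

Section Moments.
Context d (T : measurableType d) (R : realType) (P : probability T R) (N : nat).
Implicit Types (f g h : T -> R) (x y : T -> 'cV[R]_N).

Definition L1 h := P.-integrable setT (EFin \o h).

Lemma L1_le h g : measurable_fun setT h -> L1 g -> (forall w, `|h w| <= g w) ->
  L1 h.
Proof.
move=> mh ig hg; apply: (le_integrable measurableT _ _ ig).
  exact/measurable_EFinP.
by move=> w _ /=; rewrite lee_fin (le_trans (hg w))// ler_norm.
Qed.

Lemma L1_cst c : L1 (cst c).
Proof. exact: finite_measure_integrable_cst. Qed.

Lemma L1D f g : L1 f -> L1 g -> L1 (fun w => f w + g w).
Proof. by move=> fi gi; exact: (integrableD measurableT fi gi). Qed.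

Lemma L1Z c f : L1 f -> L1 (fun w => c * f w).
Proof. by move=> fi; exact: (integrableZl measurableT c fi). Qed.

Lemma L1_sum n (f : 'I_n -> T -> R) : (forall i, L1 (f i)) ->
  L1 (fun w => \sum_i f i w).
Proof.
move=> fi.
have -> : (fun w => \sum_i f i w) = \sum_i f i.
  by apply/funext => w; rewrite fct_sumE.
by elim/big_ind : _ => [|u v uL vL|//]; [exact: (L1_cst 0)|exact: L1D].
Qed.

Lemma Rintegral_sum n (f : 'I_n -> T -> R) : (forall i, L1 (f i)) ->
  \int[P]_w (\sum_i f i w) = \sum_i \int[P]_w f i w.
Proof.
elim: n f => [|n IH] f fi.
  rewrite big_ord0; under eq_Rintegral do rewrite big_ord0.
  by rewrite Rintegral_cst// mul0r.
rewrite big_ord_recl; under eq_Rintegral do rewrite big_ord_recl.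
rewrite RintegralD//; [|exact: fi|by apply: L1_sum => i; exact: fi].
by rewrite IH// => i; exact: fi.
Qed.

Lemma Rintegral_probability_cst (c : R) : \int[P]_w c = c.
Proof. 
rewrite /Rintegral integral_cst// [X in (_ * X)%E](_ : _ = 1%E) ?mule1//.
exact: probability_setT. Qed.

(** Integrability is kept together with the value of the integral, so that the
    expectation of a long expression is computed along its structure without
    separate integrability side conditions. *)
Definition has_mean h (c : R) := L1 h /\ \int[P]_w h w = c.

Lemma has_mean_cst c : has_mean (cst c) c.
Proof. split; [exact: L1_cst|exact: Rintegral_probability_cst]. Qed.

Lemma has_mean_L1 h : L1 h -> has_mean h (\int[P]_w h w).
Proof. by []. Qed.

Lemma has_meanD f g a b : has_mean f a -> has_mean g b ->
  has_mean (fun w => f w + g w) (a + b).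
Proof. by move=> [fi <-] [gi <-]; split; [exact: L1D|rewrite RintegralD]. Qed.

Lemma has_meanZ c f a : has_mean f a -> has_mean (fun w => c * f w) (c * a).
Proof. by move=> [fi <-]; split; [exact: L1Z|rewrite RintegralZl]. Qed.

Lemma has_mean_sum n (f : 'I_n -> T -> R) (a : 'I_n -> R) :
  (forall i, has_mean (f i) (a i)) ->
  has_mean (fun w => \sum_i f i w) (\sum_i a i).
Proof.
move=> fa; have fi i : L1 (f i) := (fa i).1.
split; first exact: L1_sum.
by rewrite Rintegral_sum//; apply: eq_bigr => i _; rewrite (fa i).2.
Qed.

Lemma has_mean_le f g a b : has_mean f a -> has_mean g b ->
  (forall w, f w <= g w) -> a <= b.
Proof. by move=> [fi <-] [gi <-] fg; apply: le_Rintegral. Qed.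

Definition L2 x := measurable_vec x /\ L1 (fun w => dot (x w) (x w)).

Lemma L2_dot x y : L2 x -> L2 y -> L1 (fun w => dot (x w) (y w)).
Proof.
move=> [mx ix] [my iy].
apply: (@L1_le _ (fun w => dot (x w) (x w) + dot (y w) (y w))).
- exact: measurable_dot.
- exact: L1D.
- move=> w; have := dot_ge0 (x w - y w); have := dot_ge0 (x w + y w).
  have := dot_ge0 (x w); have := dot_ge0 (y w).
  rewrite ler_norml !dotD_sqr !(dotNl, dotNr) (dotC (y w) (x w)).
  by move=> *; apply/andP; split; lra.
Qed.

Lemma L2_cst u : L2 (cst u).
Proof. split; [exact: measurable_vec_cst|exact: (L1_cst (dot u u))]. Qed.

Lemma L2D x y : L2 x -> L2 y -> L2 (fun w => x w + y w).
Proof.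
move=> Lx Ly; split; first exact: measurable_vecD Lx.1 Ly.1.
have -> : (fun w => dot (x w + y w) (x w + y w)) =
    (fun w => dot (x w) (x w) + (2 * dot (y w) (x w) + dot (y w) (y w))).
  by apply/funext => w; rewrite dotD_sqr addrA.
apply: L1D; first exact: Lx.2.
by apply: L1D Ly.2; apply: L1Z; exact: L2_dot.
Qed.

Lemma L2Z c x : L2 x -> L2 (fun w => c *: x w).
Proof.
move=> Lx; split; first exact: measurable_vecZ Lx.1.
have -> : (fun w => dot (c *: x w) (c *: x w)) = (fun w => c ^+ 2 * dot (x w) (x w)).
  by apply/funext => w; rewrite dotZl dotZr expr2 mulrA.
exact: L1Z Lx.2.
Qed.

Lemma L2B x y : L2 x -> L2 y -> L2 (fun w => x w - y w).
Proof.
move=> Lx Ly; have := L2D Lx (L2Z (-1) Ly).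
by under eq_fun do rewrite scaleN1r.
Qed.

Lemma L2_sum n (x : 'I_n -> T -> 'cV[R]_N) : (forall i, L2 (x i)) ->
  L2 (fun w => \sum_i x i w).
Proof.
move=> Lx.
have -> : (fun w => \sum_i x i w) = \sum_i x i.
  by apply/funext => w; rewrite fct_sumE.
by elim/big_ind : _ => [|u v uL vL|//]; [exact: (L2_cst 0)|exact: L2D].
Qed.

Lemma L2_mean n (x : 'I_n -> T -> 'cV[R]_N) : (forall i, L2 (x i)) ->
  L2 (fun w => mean (x ^~ w)).
Proof. by move=> Lx; apply/L2Z/L2_sum. Qed.

(** A Lipschitz gradient grows at most linearly. *)
Lemma L2_grad (L : R) (g : 'cV[R]_N -> R) x : 0 <= L -> lipschitz_grad L g ->
  L2 x -> L2 (fun w => grad g (x w)).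
Proof.
move=> L0 lg Lx; split; first exact: measurable_vec_grad lg.1 Lx.1.
apply: (@L1_le _ (fun w =>
  2 * (L ^+ 2 * dot (x w) (x w) + dot (grad g 0) (grad g 0)))).
- by apply: measurable_dot; exact: measurable_vec_grad lg.1 Lx.1.
- by apply: L1Z; apply: L1D; [exact: L1Z Lx.2|exact: (L1_cst (dot _ _))].
move=> w; rewrite ger0_norm ?dot_ge0//.
rewrite -{1 2}(subrK (grad g 0) (grad g (x w))) (le_trans (dotD_le _ _))//.
rewrite ler_wpM2l// lerD2r (le_trans (lipschitz_grad_sqr _ _ L0 lg))//.
by rewrite subr0.
Qed.

End Moments.

(** * The iterates and the noise of the stochastic gradients *)

Section MeasurableIterates.
Context dT dXi (T : measurableType dT) (Xi : measurableType dXi) (R : realType)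
  (N n : nat) (F : 'I_n -> 'cV[R]_N -> Xi -> R) (W : 'M[R]_n) (gamma : R)
  (x0 : 'cV[R]_N).
Hypothesis F_differentiable : forall i z x, differentiable (F i ^~ z) x.
Hypothesis F_measurable : forall i x, measurable_fun setT (F i x).

Lemma measurable_vec_stoch_grad i (x : T -> 'cV[R]_N) (zeta : T -> Xi) :
  measurable_vec x -> measurable_fun setT zeta ->
  measurable_vec (fun t => stoch_grad F i (x t) (zeta t)).
Proof. by move=> mx mz a; exact: measurable_grad. Qed.

Lemma measurable_vec_dpsgd (z : T -> nat -> 'I_n -> Xi) k :
  (forall l j, (l < k)%N -> measurable_fun setT (fun t => z t l j)) ->
  forall i, measurable_vec (fun t => dpsgd F W gamma x0 (z t) k i).
Proof.
elim: k => [|k IH] mz i; first exact: measurable_vec_cst.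
have {}IH := IH (fun l j lk => mz l j (ltnW lk)).
apply: measurable_vecB.
  by apply: measurable_vec_sum => j; apply: measurable_vecZ.
by apply/measurable_vecZ/measurable_vec_stoch_grad => //; exact: mz.
Qed.

End MeasurableIterates.

Section Noise.
Context (R : realType) (N n K : nat) (dXi dOmega : measure_display)
  (Xi : measurableType dXi) (Omega : measurableType dOmega)
  (D : 'I_n -> probability Xi R) (F : 'I_n -> 'cV[R]_N -> Xi -> R)
  (W : 'M[R]_n) (gamma L sigma : R) (x0 : 'cV[R]_N)
  (P : probability Omega R) (xi : nat -> 'I_n -> {RV P >-> Xi}).
Let f_ := local_loss D F.
Hypothesis F_differentiable : forall i z x, differentiable (F i ^~ z) x.
Hypothesis F_integrable : forall i x, (D i).-integrable setT (EFin \o F i x).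
Hypothesis unbiased : forall i x (j : 'I_N),
  'E_(D i)[fun z => stoch_grad F i x z j 0%R]%E = (grad (f_ i) x j 0)%:E.
Hypothesis xi_law : forall k i (A : set Xi), (k < K)%N -> measurable A ->
  distribution P (xi k i) A = D i A.
Let X (ki : 'I_K * 'I_n) := xi ki.1 ki.2.
Hypothesis xi_independent : mutually_independent X.
Hypothesis L_ge0 : 0 <= L.
Hypothesis f_lipschitz : forall i, lipschitz_grad L (f_ i).
Hypothesis sigma_bound : forall i x,
  ('E_(D i)[fun z => (enorm (stoch_grad F i x z - grad (f_ i) x) ^+ 2)%R]
   <= (sigma ^+ 2)%:E)%E.

Definition iterate k w : 'I_n -> 'cV[R]_N :=
  dpsgd F W gamma x0 (fun k i => xi k i w) k.

Definition local_gradient k w i := grad (f_ i) (iterate k w i).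

Definition noise k w i :=
  stoch_grad F i (iterate k w i) (xi k i w) - local_gradient k w i.

Let F_measurable i x : measurable_fun setT (F i x).
Proof. by move: (F_integrable i x) => /measurable_int/measurable_EFinP. Qed.

Section OneSample.
Context (i : 'I_n) (x : 'cV[R]_N).

Let g z := stoch_grad F i x z - grad (f_ i) x.

Let measurable_g : measurable_vec g.
Proof.
apply: measurable_vecB; last exact: measurable_vec_cst.
by apply: measurable_vec_stoch_grad => //; exact: measurable_vec_cst.
Qed.

Lemma noise_variance : (\int[D i]_z (dot (g z) (g z))%:E <= (sigma ^+ 2)%:E)%E.
Proof.
have := sigma_bound i x; rewrite unlock.
by under eq_integral do rewrite enorm_sqr.
Qed.

Let L1_g a : L1 (D i) (fun z => g z a 0).
Proof.
have i2 : L1 (D i) (fun z => dot (g z) (g z)).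
  apply/integrableP; split; first exact/measurable_EFinP/measurable_dot.
  rewrite (le_lt_trans _ (ltry (sigma ^+ 2)))//.
  under eq_integral do rewrite /= ger0_norm ?dot_ge0//.
  exact: noise_variance.
apply: (@L1_le _ _ _ _ _ (fun z => 1 + dot (g z) (g z))).
  - exact: measurable_g.
  - by apply: L1D => //; exact: L1_cst.
  - move=> z; have := coord_sqr_le (g z) a.
    have : 0 <= (`|g z a 0| - 1) ^+ 2 by exact: sqr_ge0.
    rewrite -(real_normK (num_real (g z a 0))) sqrrB1 => h1 h2.
    have := normr_ge0 (g z a 0); lra.
Qed.

Let coord_centered a : (\int[D i]_z (g z a 0)%:E = 0)%E.
Proof.
have := unbiased i x a; rewrite unlock.
have gE z : stoch_grad F i x z a 0 = g z a 0 + grad (f_ i) x a 0.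
  by rewrite /g !mxE subrK.
under eq_integral do rewrite gE EFinD.
rewrite (integralD_EFin measurableT (L1_g a) (L1_cst (D i) (grad (f_ i) x a 0))).
set c := grad (f_ i) x a 0.
have -> : (\int[D i]_z (EFin \o cst c) z = c%:E)%E.
  rewrite -[LHS]/(\int[D i]_z (cst c%:E z))%E integral_cst//.
  by rewrite [X in (_ * X)%E](_ : _ = 1%E) ?mule1//; exact: probability_setT.
rewrite -[X in _ = X]add0e => /(congr1 (fun u => u - c%:E)%E).
by rewrite !addeK.
Qed.

(** The variance bound makes each coordinate of the noise integrable, so that the
    unbiasedness of the stochastic gradient can be rewritten in terms of the
    noise. *)
Lemma noise_centered v : (\int[D i]_z (dot v (g z))%:E = 0)%E.
Proof.
have i1 : L1 (D i) (fun z => dot v (g z)) by apply: L1_sum => a; exact: L1Z.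
rewrite -[LHS](fineK (integrable_fin_num measurableT i1)); congr EFin.
rewrite -[LHS]/(\int[D i]_z dot v (g z)) Rintegral_sum => [|a]; last exact: L1Z.
rewrite big1// => a _; rewrite RintegralZl//; last exact: L1_g.
by rewrite /Rintegral coord_centered mulr0.
Qed.

End OneSample.

Lemma measurable_iterate k i : measurable_vec (fun w => iterate k w i).
Proof. by apply: measurable_vec_dpsgd => // l j _; exact: measurable_funP. Qed.

Lemma measurable_noise k i : measurable_vec (fun w => noise k w i).
Proof.
apply: measurable_vecB.
  by apply: measurable_vec_stoch_grad => //; exact: measurable_iterate.
by apply: measurable_vec_grad; [exact: (f_lipschitz i).1|exact: measurable_iterate].
Qed.

Notation others k i := (g_sigma_algebraType (other_cylinders X (k, i))).

(** The iterate at step [k] depends on samples of earlier steps only, and none of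
    these is the sample [(k, i)]. *)
Lemma others_iterate (k : 'I_K) i j :
  measurable_vec (iterate k ^~ j : others k i -> 'cV[R]_N).
Proof.
apply: (@measurable_vec_dpsgd _ _ (others k i)) => // l m lk.
apply: (@measurable_other_var _ _ _ _ _ P _ X (k, i)
  (Ordinal (ltn_trans lk (ltn_ord k)), m)).
by apply/eqP => -[/(congr1 val)/= kl _]; have := lk; rewrite [X in (X < _)%N]kl ltnn.
Qed.

Lemma others_local_gradient (k : 'I_K) i j :
  measurable_vec ((local_gradient k)^~ j : others k i -> 'cV[R]_N).
Proof.
by apply: measurable_vec_grad; [exact: (f_lipschitz j).1|exact: others_iterate].
Qed.

Lemma others_noise (k : 'I_K) i j : j != i ->
  measurable_vec ((noise k)^~ j : others k i -> 'cV[R]_N).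
Proof.
move=> ji; apply: measurable_vecB; last exact: others_local_gradient.
apply: measurable_vec_stoch_grad => //; first exact: others_iterate.
apply: (@measurable_other_var _ _ _ _ _ P _ X (k, i) (k, j)).
by apply: contra_neq ji => -[].
Qed.

Let joint_noise (k : 'I_K) i (u : others k i * Xi) :=
  stoch_grad F i (iterate k u.1 i) u.2 - local_gradient k u.1 i.

Let measurable_joint_noise k i : measurable_vec (@joint_noise k i).
Proof.
have mx : measurable_vec (fun u : others k i * Xi => iterate k u.1 i).
  move=> a; exact: (measurableT_comp (@others_iterate k i i a) measurable_fst).
apply: measurable_vecB; first exact: measurable_vec_stoch_grad.
by apply: measurable_vec_grad => //; exact: (f_lipschitz i).1.
Qed.

Let xi_indep (k : 'I_K) i := other_indep (i0 := (k, i)) xi_independent.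

Let law_integral (k : 'I_K) i (g : Xi -> \bar R) :
  (\int[distribution P (X (k, i))]_z g z = \int[D i]_z g z)%E.
Proof. by apply: eq_measure_integral => A mA _; exact: xi_law. Qed.

(** Freeze the iterate and integrate over the fresh sample, for which the variance
    bound is uniform in the point. *)
Lemma noise_second_moment_lee (k : 'I_K) i :
  (\int[P]_w (dot (noise k w i) (noise k w i))%:E <= (sigma ^+ 2)%:E)%E.
Proof.
have mf :
    measurable_fun setT (fun u => (dot (@joint_noise k i u) (joint_noise u))%:E).
  by apply/measurable_EFinP/measurable_dot.
have f0 u : (0 <= (dot (@joint_noise k i u) (joint_noise u))%:E)%E.
  by rewrite lee_fin dot_ge0.
have := ge0_freezing (@xi_indep k i) mf f0; rewrite /= => ->.
under eq_integral do rewrite law_integral.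
apply: (@le_trans _ _ (\int[P]_w (sigma ^+ 2)%:E)%E); last first.
  rewrite integral_cst// [X in (_ * X <= _)%E](_ : _ = 1%E) ?mule1//.
  exact: probability_setT.
apply: ge0_le_integral => //.
- by move=> w _; apply: integral_ge0 => z _; rewrite lee_fin dot_ge0.
- have mF := @measurable_fun_fubini_tonelli_F _ _ _ _ _ (D i) _ mf f0.
  have := measurableT_comp mF (@measurable_other_id _ _ _ _ _ P _ X (k, i)).
  exact.
- by move=> w _; exact: (noise_variance i (iterate k w i)).
Qed.

Lemma L2_noise (k : 'I_K) i : L2 P (noise k ^~ i).
Proof.
split; first exact: measurable_noise.
apply/integrableP; split.
  by apply/measurable_EFinP/measurable_dot; exact: measurable_noise.
rewrite (le_lt_trans _ (ltry (sigma ^+ 2)))//.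
under eq_integral do rewrite /= ger0_norm ?dot_ge0//.
exact: noise_second_moment_lee.
Qed.

Lemma noise_second_moment (k : 'I_K) i :
  \int[P]_w dot (noise k w i) (noise k w i) <= sigma ^+ 2.
Proof.
rewrite -lee_fin fineK ?noise_second_moment_lee//.
exact: integrable_fin_num (L2_noise k i).2.
Qed.

Lemma L2_local_gradient k i : L2 P (iterate k ^~ i) -> L2 P (local_gradient k ^~ i).
Proof. exact: (L2_grad L_ge0 (f_lipschitz i)). Qed.

(** Each step adds a stochastic gradient, the sum of a local gradient and a noise,
    both square-integrable. *)
Lemma L2_iterate k i : (k <= K)%N -> L2 P (iterate k ^~ i).
Proof.
elim: k i => [|k IH] i kK; first exact: L2_cst.
have Lx j := IH j (ltnW kK).
apply: L2B; first by apply: L2_sum => j; apply: L2Z; exact: Lx.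
have LG := L2D (L2_noise (Ordinal kK) i) (L2_local_gradient (Lx i)).
apply: L2Z; move: LG; under eq_fun do rewrite subrK; exact.
Qed.

(** Freeze all the samples other than [(k, i)]: then the vector and the iterate are
    fixed, and the noise has mean zero over the remaining sample. *)
Lemma noise_orthogonal (k : 'I_K) i (V : Omega -> 'cV[R]_N) :
  L2 P V -> measurable_vec (V : others k i -> 'cV[R]_N) ->
  \int[P]_w dot (V w) (noise k w i) = 0.
Proof.
move=> LV mV; rewrite /Rintegral.
pose f (u : others k i * Xi) := dot (V u.1) (joint_noise u).
have mf : measurable_fun setT f.
  apply: measurable_dot => // a.
  exact: (measurableT_comp (mV a) measurable_fst).
have fi := L2_dot LV (L2_noise k i).
have := freezing0 (@xi_indep k i) mf fi; rewrite /= => -> // w.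
by rewrite law_integral; exact: (noise_centered i (iterate k w i) (V w)).
Qed.

Hypothesis n_gt0 : (0 < n)%N.
Hypothesis gamma_gt0 : 0 < gamma.
Hypothesis W_sym : forall i j, W i j = W j i.
Hypothesis W_stochastic : forall i, \sum_j W i j = 1.
Hypothesis spectral_gap : rho W < 1.
Context (varsigma : R).
Hypothesis varsigma_bound : forall x,
  n%:R^-1 * \sum_i enorm (grad (f_ i) x - grad (loss D F) x) ^+ 2
  <= varsigma ^+ 2.
Hypothesis f_bounded_below : has_lbound (range (loss D F)).

Let f := loss D F.
Let q := Num.sqrt (rho W).
(** A bar denotes the average over the nodes. *)
Definition xbar k w := mean (iterate k w).
Definition gbar k w := mean (local_gradient k w).
Definition ebar k w := mean (noise k w).
Definition disagreement k w := spread (iterate k w).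
Definition df_xbar k w := grad f (xbar k w).

Let f_lip : lipschitz_grad L f. Proof. exact: lipschitz_grad_loss. Qed.

Let n_neq0 : n%:R != 0 :> R. Proof. by rewrite pnatr_eq0 -lt0n. Qed.

Let q1 : 0 < 1 - q. Proof. by rewrite subr_gt0 sqrt_rho_lt1. Qed.

Lemma iterateS k w : iterate k.+1 w = fun i =>
  \sum_j W i j *: iterate k w j - gamma *: (local_gradient k w i + noise k w i).
Proof. by apply/funext => i; rewrite [_ + noise _ _ _]addrC subrK. Qed.

Lemma xbarS k w : xbar k.+1 w - xbar k w = - (gamma *: (gbar k w + ebar k w)).
Proof.
rewrite /xbar iterateS meanD mean_mix// addrAC subrr add0r.
rewrite -[RHS]scaleNr /gbar /ebar -meanD -meanZ; congr mean.
by apply/funext => i; rewrite scaleNr.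
Qed.

(** The difference is the average over the nodes of the changes of the local
    gradients between the common average and the local iterates. *)
Lemma gradient_bias k w :
  dot (df_xbar k w - gbar k w) (df_xbar k w - gbar k w) <=
  L ^+ 2 / n%:R * disagreement k w.
Proof.
have -> : df_xbar k w - gbar k w =
    mean (fun i => grad (f_ i) (xbar k w) - local_gradient k w i).
  rewrite /df_xbar (grad_loss (fun i => (f_lipschitz i).1 _)).
  rewrite meanD -scaleN1r -meanZ; congr (_ + mean _).
  by apply/funext => i; rewrite scaleN1r.
rewrite (le_trans (dot_mean_le n_gt0 _))// [L ^+ 2 / _]mulrC -mulrA.
rewrite ler_wpM2l ?invr_ge0//.
rewrite /disagreement mulr_sumr; apply: ler_sum => i _.
rewrite (le_trans (lipschitz_grad_sqr _ _ L_ge0 (f_lipschitz i)))//.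
by rewrite /deviation -(opprB (iterate _ _ _)) dotNl dotNr opprK.
Qed.

(** The spread is at most the sum of squared distances to the gradient of the
    average loss, and each of these splits into the change of the local gradient
    between the iterate and the average and the dissimilarity of the losses. *)
Lemma gradient_spread k w :
  spread (local_gradient k w) <=
  2 * (L ^+ 2 * disagreement k w + n%:R * varsigma ^+ 2).
Proof.
rewrite (le_trans (spread_le n_gt0 _ (df_xbar k w)))//.
have vs : \sum_i dot (grad (f_ i) (xbar k w) - df_xbar k w)
    (grad (f_ i) (xbar k w) - df_xbar k w) <= n%:R * varsigma ^+ 2.
  have := varsigma_bound (xbar k w); rewrite ler_pdivrMl ?ltr0n//.
  by under eq_bigr do rewrite enorm_sqr.
apply: (@le_trans _ _ (2 * (L ^+ 2 * disagreement k w +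
    \sum_i dot (grad (f_ i) (xbar k w) - df_xbar k w)
      (grad (f_ i) (xbar k w) - df_xbar k w)))); last first.
  by rewrite ler_wpM2l// lerD2l.
rewrite /disagreement [L ^+ 2 * _]mulr_sumr -big_split mulr_sumr.
apply: ler_sum => i _ /=.
rewrite -(subrK (grad (f_ i) (xbar k w)) (local_gradient k w i)) -addrA.
rewrite (le_trans (dotD_le _ _))// ler_wpM2l// lerD2r.
exact: (lipschitz_grad_sqr _ _ L_ge0 (f_lipschitz i)).
Qed.

(** Polarization of the inner product of [df_xbar] and [gbar] produces the two
    squared norms on the left and the bias, which [gradient_bias] turns into
    disagreement. The terms containing [ebar] are kept for the expectation. *)
Lemma descent_step k w :
  gamma * (1 - gamma * L) / 2 * dot (gbar k w) (gbar k w)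
  + gamma / 2 * dot (df_xbar k w) (df_xbar k w) <=
  f (xbar k w) - f (xbar k.+1 w)
  + (gamma * L ^+ 2 / (2 * n%:R) * disagreement k w
  + (gamma ^+ 2 * L / 2 * dot (ebar k w) (ebar k w)
  + dot ((gamma ^+ 2 * L) *: gbar k w - gamma *: df_xbar k w) (ebar k w))).
Proof.
have := descent_inequality (xbar k w) (xbar k.+1 w) L_ge0 f_lip.
rewrite xbarS -/(df_xbar k w) -/f.
have := ler_wpM2l (ltW (divr_gt0 gamma_gt0 (ltr0n _ 2))) (gradient_bias k w).
move: (gbar k w) (ebar k w) (df_xbar k w) => g e d.
rewrite !(dotD_sqr, dotNr, dotNl, opprK, dotZl, dotZr, dotDl, dotDr).
rewrite (dotC e g) (dotC g d).
have -> : gamma / 2 * (L ^+ 2 / n%:R * disagreement k w) =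
    gamma * L ^+ 2 / (2 * n%:R) * disagreement k w.
  by field.
lra.
Qed.

(** Summed for each outcome, the values of the loss telescope, so that only its
    values at the start and at the end enter, and the latter has a lower bound. *)
Lemma telescoped_descent k w :
  \sum_(l < k) (gamma * (1 - gamma * L) / 2 * dot (gbar l w) (gbar l w)
  + gamma / 2 * dot (df_xbar l w) (df_xbar l w)) <=
  f x0 - f (xbar k w)
  + \sum_(l < k) (gamma * L ^+ 2 / (2 * n%:R) * disagreement l w
  + (gamma ^+ 2 * L / 2 * dot (ebar l w) (ebar l w)
  + dot ((gamma ^+ 2 * L) *: gbar l w - gamma *: df_xbar l w) (ebar l w))).
Proof.
elim: k => [|k IH].
  by rewrite !big_ord0 /xbar /iterate/= mean_cst// subrr addr0.
rewrite !big_ord_recr/=; have := descent_step k w; move: IH.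
set A := \sum_(_ < _) _; set B := \sum_(_ < _) _; lra.
Qed.

Lemma spread_recursion k w :
  disagreement k.+1 w <= (q + 2 * gamma ^+ 2 * L ^+ 2 / (1 - q)) * disagreement k w
  + (2 * gamma ^+ 2 * n%:R * varsigma ^+ 2 / (1 - q)
  + (- (2 * gamma) * \sum_i dot (mixed_drift W gamma (iterate k w)
       (local_gradient k w) i) (noise k w i)
  + gamma ^+ 2 * \sum_i dot (noise k w i) (noise k w i))).
Proof.
rewrite {1}/disagreement iterateS.
rewrite (le_trans (spread_step n_gt0 W_sym W_stochastic spectral_gap _ _ _ _))//.
have := ler_wpM2l (divr_ge0 (sqr_ge0 gamma) (ltW q1)) (gradient_spread k w).
rewrite -/q -/(disagreement k w).
have -> : gamma ^+ 2 / (1 - q) *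
      (2 * (L ^+ 2 * disagreement k w + n%:R * varsigma ^+ 2)) =
    2 * gamma ^+ 2 * L ^+ 2 / (1 - q) * disagreement k w
    + 2 * gamma ^+ 2 * n%:R * varsigma ^+ 2 / (1 - q).
  by field; rewrite gt_eqF.
lra.
Qed.

Let L2_xbar k : (k <= K)%N -> L2 P (xbar k).
Proof. by move=> kK; apply: L2_mean => i; exact: L2_iterate. Qed.

Let L2_g k i : (k <= K)%N -> L2 P (local_gradient k ^~ i).
Proof. by move=> kK; apply/L2_local_gradient/L2_iterate. Qed.

Lemma L2_gbar k : (k <= K)%N -> L2 P (gbar k).
Proof. by move=> kK; apply: L2_mean => i; exact: L2_g. Qed.

Lemma L2_df_xbar k : (k <= K)%N -> L2 P (df_xbar k).
Proof. by move=> kK; apply: (L2_grad L_ge0 f_lip); exact: L2_xbar. Qed.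

Let L2_ebar (k : 'I_K) : L2 P (ebar k).
Proof. by apply: L2_mean => i; exact: L2_noise. Qed.

Let L1_disagreement k : (k <= K)%N -> L1 P (disagreement k).
Proof.
move=> kK; apply: L1_sum => i.
by have [_] := L2B (L2_iterate i kK) (L2_xbar kK).
Qed.

Let L2_drift k i : (k <= K)%N ->
  L2 P (fun w => mixed_drift W gamma (iterate k w) (local_gradient k w) i).
Proof.
move=> kK; apply: L2B.
  by apply: L2_sum => j; apply: L2Z; apply: L2B; [exact: L2_iterate|exact: L2_xbar].
by apply: L2Z; apply: L2B; [exact: L2_g|exact: L2_gbar].
Qed.

Lemma drift_orthogonal (k : 'I_K) i :
  \int[P]_w dot (mixed_drift W gamma (iterate k w) (local_gradient k w) i)
    (noise k w i) = 0.
Proof.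
apply: noise_orthogonal; first by apply: L2_drift; exact: ltnW.
apply: measurable_vecB.
  apply: measurable_vec_sum => j; apply/measurable_vecZ/measurable_vecB.
    exact: others_iterate.
  by apply: measurable_vec_mean => l; exact: others_iterate.
apply/measurable_vecZ/measurable_vecB; first exact: others_local_gradient.
by apply: measurable_vec_mean => l; exact: others_local_gradient.
Qed.

Lemma ebar_orthogonal (k : 'I_K) a b :
  \int[P]_w dot (a *: gbar k w - b *: df_xbar k w) (ebar k w) = 0.
Proof.
have LV : L2 P (fun w => a *: gbar k w - b *: df_xbar k w).
  by apply: L2B; apply: L2Z; [apply: L2_gbar|apply: L2_df_xbar]; exact: ltnW.
have m0 : has_mean P
   (fun w => dot (a *: gbar k w - b *: df_xbar k w) (ebar k w))
   (n%:R^-1 * \sum_(i < n) 0).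
  have -> : (fun w => dot (a *: gbar k w - b *: df_xbar k w) (ebar k w)) =
      (fun w => n%:R^-1 *
         \sum_i dot (a *: gbar k w - b *: df_xbar k w) (noise k w i)).
    by apply/funext => w; rewrite /ebar dotZr dot_sumr.
  apply/has_meanZ/has_mean_sum => i; split; first exact: L2_dot LV (L2_noise k i).
  apply: noise_orthogonal => //; apply: measurable_vecB; apply: measurable_vecZ.
    by apply: measurable_vec_mean => l; exact: others_local_gradient.
  apply: measurable_vec_grad; first exact: f_lip.1.
  by apply: measurable_vec_mean => l; exact: others_iterate.
by rewrite m0.2 big1 ?mulr0.
Qed.

(** The noises of different nodes are orthogonal: the [n ^ 2] products in the square
    of the average leave only [n] nonzero ones. *)
Lemma ebar_second_moment (k : 'I_K) :
  \int[P]_w dot (ebar k w) (ebar k w) <= sigma ^+ 2 / n%:R.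
Proof.
pose a i j := \int[P]_w dot (noise k w j) (noise k w i).
have m : has_mean P (fun w => dot (ebar k w) (ebar k w))
   (n%:R^-1 * (n%:R^-1 * \sum_i \sum_j a i j)).
  have -> : (fun w => dot (ebar k w) (ebar k w)) = (fun w =>
      n%:R^-1 * (n%:R^-1 * \sum_i \sum_j dot (noise k w j) (noise k w i))).
    apply/funext => w; rewrite /ebar dotZr dotZl; congr (_ * (_ * _)).
    rewrite dot_sumr; apply: eq_bigr => i _.
    by rewrite dotC dot_sumr; apply: eq_bigr => j _; rewrite dotC.
  do 2 apply: has_meanZ; apply: has_mean_sum => i; apply: has_mean_sum => j.
  by apply: has_mean_L1; apply: L2_dot; exact: L2_noise.
have aii i : \sum_j a i j <= sigma ^+ 2.
  rewrite (bigD1 i)//= big1 ?addr0; first exact: noise_second_moment.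
  move=> j ji; apply: noise_orthogonal; first exact: L2_noise.
  exact: others_noise.
rewrite m.2 [sigma ^+ 2 / _]mulrC ler_wpM2l ?invr_ge0// ler_pdivrMl ?ltr0n//.
rewrite mulr_natl -[X in _ *+ X]card_ord -sumr_const; exact: ler_sum.
Qed.

Lemma expected_spread_recursion (k : 'I_K) :
  \int[P]_w disagreement k.+1 w <=
  (q + 2 * gamma ^+ 2 * L ^+ 2 / (1 - q)) * \int[P]_w disagreement k w
  + (2 * gamma ^+ 2 * n%:R * varsigma ^+ 2 / (1 - q)
     + gamma ^+ 2 * n%:R * sigma ^+ 2).
Proof.
have kK := ltnW (ltn_ord k).
pose b i := \int[P]_w dot (noise k w i) (noise k w i).
apply: (@le_trans _ _
 ((q + 2 * gamma ^+ 2 * L ^+ 2 / (1 - q)) * \int[P]_w disagreement k w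
  + (2 * gamma ^+ 2 * n%:R * varsigma ^+ 2 / (1 - q) +
     (- (2 * gamma) * (\sum_(i < n) 0) + gamma ^+ 2 * \sum_i b i)))); last first.
  rewrite !lerD2l big1// mulr0 add0r -mulrA ler_wpM2l ?sqr_ge0//.
  rewrite mulr_natl -[X in _ *+ X]card_ord -sumr_const.
  by apply: ler_sum => i _; exact: noise_second_moment.
apply: (has_mean_le (has_mean_L1 (L1_disagreement (ltn_ord k))) _
  (spread_recursion k)).
apply: has_meanD; first by apply/has_meanZ/has_mean_L1/L1_disagreement.
apply: has_meanD; first exact: has_mean_cst.
apply: has_meanD; apply: has_meanZ; apply: has_mean_sum => i.
  split; last exact: drift_orthogonal.
  exact: L2_dot (L2_drift i kK) (L2_noise k i).
exact/has_mean_L1/(L2_noise k i).2.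
Qed.

Lemma expected_descent :
  gamma * (1 - gamma * L) / 2 *
    (\sum_(k < K) \int[P]_w dot (gbar k w) (gbar k w))
  + gamma / 2 *
    (\sum_(k < K) \int[P]_w dot (df_xbar k w) (df_xbar k w)) <=
  f x0 - inf (range f)
  + (gamma * L ^+ 2 / (2 * n%:R) * (\sum_(k < K) \int[P]_w disagreement k w)
     + K%:R * (gamma ^+ 2 * L / 2 * (sigma ^+ 2 / n%:R))).
Proof.
pose b (k : 'I_K) := \int[P]_w dot (ebar k w) (ebar k w).
apply: (@le_trans _ _ (f x0 - inf (range f) + \sum_(k < K)
  (gamma * L ^+ 2 / (2 * n%:R) * (\int[P]_w disagreement k w)
   + (gamma ^+ 2 * L / 2 * b k + 0)))); last first.
  rewrite lerD2l mulr_sumr big_split lerD2l/=.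
  rewrite -[X in X%:R * _]card_ord mulr_natl -sumr_const; apply: ler_sum => k _.
  rewrite addr0 ler_wpM2l ?ebar_second_moment//.
  by rewrite divr_ge0// mulr_ge0// sqr_ge0.
rewrite !mulr_sumr -big_split/=.
have kK (k : 'I_K) := ltnW (ltn_ord k).
pose B w := f x0 - inf (range f) + \sum_(k < K)
  (gamma * L ^+ 2 / (2 * n%:R) * disagreement k w
   + (gamma ^+ 2 * L / 2 * dot (ebar k w) (ebar k w)
   + dot ((gamma ^+ 2 * L) *: gbar k w - gamma *: df_xbar k w) (ebar k w))).
apply: (@has_mean_le _ _ _ _ _ B _ _ _ _
  (fun w => le_trans (telescoped_descent K w) _)).
- apply: has_mean_sum => k; apply: has_meanD; apply: has_meanZ; apply: has_mean_L1.
    exact: (L2_gbar (kK k)).2.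
  exact: (L2_df_xbar (kK k)).2.
- apply: has_meanD; first exact: has_mean_cst.
  apply: has_mean_sum => k; apply: has_meanD.
    by apply/has_meanZ/has_mean_L1/L1_disagreement.
  apply: has_meanD; first by apply/has_meanZ/has_mean_L1; exact: (L2_ebar k).2.
  split; last exact: ebar_orthogonal.
  apply: L2_dot (L2_ebar k).
  by apply: L2B; apply: L2Z; [exact: L2_gbar|exact: L2_df_xbar].
- by move=> w; rewrite lerD2r lerD2l lerN2; apply: ge_inf.
Qed.

(** Shifting the recursion by one step loses nothing: the disagreement is zero at
    the start and nonnegative at the end. *)
Lemma expected_spread_sum :
  (1 - q - 2 * gamma ^+ 2 * L ^+ 2 / (1 - q)) *
    (\sum_(k < K) \int[P]_w disagreement k w) <=
  K%:R * (2 * gamma ^+ 2 * n%:R * varsigma ^+ 2 / (1 - q)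
     + gamma ^+ 2 * n%:R * sigma ^+ 2).
Proof.
set S := \sum_(k < K) _; set c := q + 2 * gamma ^+ 2 * L ^+ 2 / (1 - q).
set b := _ + gamma ^+ 2 * n%:R * sigma ^+ 2.
have V0 : \int[P]_w disagreement 0 w = 0.
  rewrite -[RHS](Rintegral_probability_cst P); apply: eq_Rintegral => w _.
  rewrite /disagreement /spread big1// => i _.
  by rewrite /deviation /iterate/= mean_cst// subrr dot0r.
have shift : S <= \sum_(k < K) \int[P]_w disagreement k.+1 w.
  have VK : 0 <= \int[P]_w disagreement K w.
    by apply: Rintegral_ge0 => w _; exact: spread_ge0.
  have : \sum_(k < K.+1) \int[P]_w disagreement k w = S + \int[P]_w disagreement K w.
    by rewrite big_ord_recr.
  by rewrite big_ord_recl/= V0 add0r => ->; rewrite lerDl.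
have : \sum_(k < K) \int[P]_w disagreement k.+1 w <= c * S + K%:R * b.
  rewrite -[X in X%:R * _]card_ord mulr_natl -sumr_const /S mulr_sumr -big_split.
  by apply: ler_sum => k _; exact: expected_spread_recursion.
rewrite /c in shift *; move: shift; set t := 2 * gamma ^+ 2 * L ^+ 2 / (1 - q).
lra.
Qed.
End Noise.

(** * The convergence rate *)

Lemma averageE (R : realType) (N n : nat) (X : 'M[R]_(N, n)) :
  average X = mean (fun i => col i X).
Proof.
apply/colP => a; rewrite !mxE summxE; congr (_ * _).
by apply: eq_bigr => i _; rewrite !mxE mulr1.
Qed.

(** The bound on the total disagreement [S] holds with [1 - 2 t] in place of [D2],
    where [t = (gamma L / (1 - q)) ^ 2] and [D2 = 1 - 18 n t]; the numerical
    factors of the claim leave room for [1 - q ^+ 2 <= 2 * (1 - q)] and for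
    replacing [D1] by [2^-1]. *)
Lemma rate_arithmetic (R : realFieldType) (n K : nat)
    (gamma L q s v G H S Delta : R) :
  let D2 := 1 - 18 * gamma ^+ 2 / (1 - q) ^+ 2 * n%:R * L ^+ 2 in
  let D1 := 2^-1 - 9 * gamma ^+ 2 * L ^+ 2 * n%:R / ((1 - q) ^+ 2 * D2) in
  (0 < n)%N -> (0 < K)%N -> 0 < gamma -> 0 <= L -> 0 <= q -> q < 1 -> 0 < D2 ->
  0 <= s -> 0 <= v -> 0 <= H -> 0 <= S ->
  gamma * (1 - gamma * L) / 2 * G + gamma / 2 * H <=
    Delta + (gamma * L ^+ 2 / (2 * n%:R) * S
             + K%:R * (gamma ^+ 2 * L / 2 * (s / n%:R))) ->
  (1 - q - 2 * gamma ^+ 2 * L ^+ 2 / (1 - q)) * S <=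
    K%:R * (2 * gamma ^+ 2 * n%:R * v / (1 - q) + gamma ^+ 2 * n%:R * s) ->
  K%:R^-1 * ((1 - gamma * L) / 2 * G + D1 * H) <=
    Delta / (gamma * K%:R) + gamma * L / (2 * n%:R) * s
    + gamma ^+ 2 * L ^+ 2 * n%:R * s / ((1 - q ^+ 2) * D2)
    + 9 * gamma ^+ 2 * L ^+ 2 * n%:R * v / ((1 - q) ^+ 2 * D2).
Proof.
move=> D2 D1 n0 K0 g0 L0 q0 q1 D20 s0 v0 H0 S0 hdescent hspread.
have p0 : 0 < 1 - q by rewrite subr_gt0.
have gL0 : 0 <= gamma ^+ 2 * L ^+ 2 by rewrite mulr_ge0 ?sqr_ge0.
have gLs0 : 0 <= gamma ^+ 2 * L ^+ 2 * s by rewrite mulr_ge0.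
have gLv0 : 0 <= gamma ^+ 2 * L ^+ 2 * v by rewrite mulr_ge0.
have nR : 1 <= n%:R :> R by rewrite ler1n.
have nR0 : 0 < n%:R :> R by rewrite ltr0n.
have KR : 0 < K%:R :> R by rewrite ltr0n.
pose t := gamma ^+ 2 * L ^+ 2 / (1 - q) ^+ 2.
have sq0 (x : R) : 0 <= x ^+ 2 by exact: sqr_ge0.
have t0 : 0 <= t by rewrite divr_ge0// mulr_ge0.
have D2E : D2 = 1 - 18 * (n%:R * t) by rewrite /D2 /t; field; rewrite gt_eqF.
have tn : t <= n%:R * t by rewrite ler_peMl.
have D2t : D2 <= 1 - 2 * t by rewrite D2E; lra.
have hS : (1 - q) * D2 * S <=
    K%:R * (2 * gamma ^+ 2 * n%:R * v / (1 - q) + gamma ^+ 2 * n%:R * s).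
  apply: le_trans hspread.
  have -> : 1 - q - 2 * gamma ^+ 2 * L ^+ 2 / (1 - q) = (1 - q) * (1 - 2 * t).
    by rewrite /t; field; rewrite gt_eqF.
  by rewrite ler_wpM2r// ler_wpM2l// ltW.
have hLS : L ^+ 2 / (2 * n%:R * K%:R) * S <=
    gamma ^+ 2 * L ^+ 2 * n%:R * s / ((1 - q ^+ 2) * D2)
    + 9 * gamma ^+ 2 * L ^+ 2 * n%:R * v / ((1 - q) ^+ 2 * D2).
  have -> : L ^+ 2 / (2 * n%:R * K%:R) * S =
      L ^+ 2 / (2 * n%:R * K%:R * ((1 - q) * D2)) * ((1 - q) * D2 * S).
    by field; rewrite !gt_eqF.
  apply: (@le_trans _ _ (L ^+ 2 / (2 * n%:R * K%:R * ((1 - q) * D2)) *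
      (K%:R * (2 * gamma ^+ 2 * n%:R * v / (1 - q) + gamma ^+ 2 * n%:R * s)))).
    by rewrite ler_wpM2l// divr_ge0 ?sqr_ge0// !mulr_ge0// ?ltW.
  have -> : L ^+ 2 / (2 * n%:R * K%:R * ((1 - q) * D2)) *
      (K%:R * (2 * gamma ^+ 2 * n%:R * v / (1 - q) + gamma ^+ 2 * n%:R * s)) =
      gamma ^+ 2 * L ^+ 2 * s / (2 * (1 - q) * D2)
      + gamma ^+ 2 * L ^+ 2 * v / ((1 - q) ^+ 2 * D2).
    by field; rewrite !gt_eqF.
  apply: lerD.
    apply: (@le_trans _ _ (gamma ^+ 2 * L ^+ 2 * s / ((1 - q ^+ 2) * D2))).
      rewrite ler_wpM2l// lef_pV2 ?posrE.
      - by rewrite ler_pM2r//; nra.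
      - by rewrite !mulr_gt0.
      - by rewrite mulr_gt0// subr_gt0 expr_lt1.
    rewrite [_ * n%:R * s]mulrAC.
    apply: ler_wpM2r; last by rewrite ler_peMr.
    by rewrite invr_ge0 mulr_ge0 ?(ltW D20)// subr_ge0 expr_le1// ltW.
  apply: ler_wpM2r; first by rewrite invr_ge0 mulr_ge0 ?sq0 ?(ltW D20).
  have -> : 9 * gamma ^+ 2 * L ^+ 2 * n%:R * v =
    (9 * n%:R) * (gamma ^+ 2 * L ^+ 2 * v) by ring.
  by rewrite ler_peMl//; lra.
have D1H : D1 * H <= 2^-1 * H.
  rewrite ler_wpM2r// gerBl divr_ge0//; last by rewrite mulr_ge0 ?sq0 ?(ltW D20).
  have -> : 9 * gamma ^+ 2 * L ^+ 2 * n%:R = 9 * n%:R * (gamma ^+ 2 * L ^+ 2).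
    by ring.
  by rewrite mulr_ge0// mulr_ge0.
have gK : 0 < gamma * K%:R by rewrite mulr_gt0.
have -> : K%:R^-1 * ((1 - gamma * L) / 2 * G + D1 * H) =
  (gamma * K%:R)^-1 * (gamma * (1 - gamma * L) / 2 * G + gamma * (D1 * H)).
  by field; rewrite !gt_eqF.
apply: (@le_trans _ _ ((gamma * K%:R)^-1 * (Delta + (gamma * L ^+ 2 / (2 * n%:R) * S
             + K%:R * (gamma ^+ 2 * L / 2 * (s / n%:R)))))).
  rewrite ler_wpM2l ?invr_ge0 ?(ltW gK)// (le_trans _ hdescent)// lerD2l.
  by rewrite -mulrA ler_pM2l.
have -> : (gamma * K%:R)^-1 * (Delta + (gamma * L ^+ 2 / (2 * n%:R) * S
             + K%:R * (gamma ^+ 2 * L / 2 * (s / n%:R)))) =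
  Delta / (gamma * K%:R) + gamma * L / (2 * n%:R) * s
  + L ^+ 2 / (2 * n%:R * K%:R) * S.
  by field; rewrite !gt_eqF.
by rewrite -!addrA !lerD2l.
Qed.

Theorem theorem1 (R : realType) (N n K : nat)
    (dXi dOmega : measure_display)
    (Xi : measurableType dXi) (Omega : measurableType dOmega)
    (D : 'I_n -> probability Xi R) (F : 'I_n -> 'cV[R]_N -> Xi -> R)
    (W : 'M[R]_n) (gamma L sigma varsigma : R) (x0 : 'cV[R]_N)
    (P : probability Omega R) (xi : nat -> 'I_n -> {RV P >-> Xi}) :
  let f_ := local_loss D F in
  let f := loss D F in
  let fstar := inf (range f) in
  let X := fun (k : nat) (w : Omega) =>
    dpsgd_mx F W gamma x0 (fun k i => xi k i w) k in
  let r := rho W in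
  let D2 := 1 - 18 * gamma ^+ 2 / (1 - Num.sqrt r) ^+ 2 * n%:R * L ^+ 2 in
  let D1 := 2^-1 - 9 * gamma ^+ 2 * L ^+ 2 * n%:R
                   / ((1 - Num.sqrt r) ^+ 2 * D2) in
  forall
    (n_gt0 : (0 < n)%N) (K_ge1 : (1 <= K)%N) (gamma_gt0 : 0 < gamma)
    (D2_gt0 : 0 < D2)
    (* the problem *)
    (F_differentiable : forall i z x, differentiable (F i ^~ z) x)
    (F_integrable : forall i x, (D i).-integrable setT (EFin \o F i x))
    (f_bounded_below : has_lbound (range f))
    (unbiased : forall i x (j : 'I_N),
      'E_(D i)[fun z => stoch_grad F i x z j 0%R]%E = (grad (f_ i) x j 0)%:E)
    (* the weight matrix *)
    (W_sym : forall i j, W i j = W j i)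
    (W_01 : forall i j, 0 <= W i j <= 1)
    (W_stochastic : forall i, \sum_j W i j = 1)
    (* the samples *)
    (xi_law : forall k i (A : set Xi), (k < K)%N -> measurable A ->
      distribution P (xi k i) A = D i A)
    (xi_independent :
      mutually_independent (fun ki : 'I_K * 'I_n => xi ki.1 ki.2))
    (* Assumption 1 *)
    (L_ge0 : 0 <= L)
    (f_lipschitz : forall i, lipschitz_grad L (f_ i))
    (spectral_gap : r < 1)
    (variance_bounded : exists B : R, forall x,
      ((n%:R^-1)%:E *
       \sum_i 'E_(D i)[fun z => (enorm (stoch_grad F i x z - grad f x) ^+ 2)%R]
       <= B%:E)%E)
    (sigma_bound : forall i x,
      ('E_(D i)[fun z => (enorm (stoch_grad F i x z - grad (f_ i) x) ^+ 2)%R]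
       <= (sigma ^+ 2)%:E)%E)
    (varsigma_bound : forall x,
      n%:R^-1 * \sum_i enorm (grad (f_ i) x - grad f x) ^+ 2
      <= varsigma ^+ 2)
    (start_0 : x0 = 0),
  ((K%:R^-1)%:E *
   (((1 - gamma * L) / 2)%:E *
      (\sum_(k < K)
         'E_P[fun w => (enorm (average (local_grads D F (X k w))) ^+ 2)%R])
    + D1%:E *
      (\sum_(k < K) 'E_P[fun w => (enorm (grad f (average (X k w))) ^+ 2)%R]))
   <= ((f 0 - fstar) / (gamma * K%:R)
       + gamma * L / (2 * n%:R) * sigma ^+ 2
       + gamma ^+ 2 * L ^+ 2 * n%:R * sigma ^+ 2 / ((1 - r) * D2)
       + 9 * gamma ^+ 2 * L ^+ 2 * n%:R * varsigma ^+ 2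
         / ((1 - Num.sqrt r) ^+ 2 * D2))%:E)%E.
Proof.
move=> f_ f fstar X r D2 D1 n_gt0 K_ge1 gamma_gt0 D2_gt0 F_diff F_int f_lb unb
  W_sym _ W_stoch xi_law xi_indep L_ge0 f_lip gap _ sigma_b varsigma_b x0_0.
pose g := gbar D F W gamma x0 xi.
pose df := df_xbar D F W gamma x0 xi.
have colX k w i : col i (X k w) = iterate F W gamma x0 xi k w i.
  by apply/colP => a; rewrite !mxE.
have avG k w : average (local_grads D F (X k w)) = g k w.
  rewrite averageE; congr mean; apply/funext => i.
  by apply/colP => a; rewrite 2!mxE colX.
have avX k w : grad f (average (X k w)) = df k w.
  rewrite averageE /df /df_xbar; congr (grad f (mean _)).
  by apply/funext => i; rewrite colX.
have kK (k : 'I_K) : (k <= K)%N := ltnW (ltn_ord k).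
have L2g (k : 'I_K) : L2 P (g k).
  exact: (L2_gbar _ _ _ F_diff F_int xi_law xi_indep L_ge0 f_lip sigma_b
    (kK k)).
have L2df (k : 'I_K) : L2 P (df k).
  exact: (L2_df_xbar _ _ _ F_diff F_int xi_law xi_indep L_ge0 f_lip sigma_b
    n_gt0 (kK k)).
have expectE (Y Z : Omega -> 'cV[R]_N) : L2 P Z -> (forall w, Y w = Z w) ->
    'E_P[fun w => (enorm (Y w) ^+ 2)%R]%E = (\int[P]_w dot (Z w) (Z w))%:E.
  move=> [_ iZ] YZ; rewrite unlock fineK; last exact: integrable_fin_num iZ.
  by apply: eq_integral => w _; rewrite enorm_sqr YZ.
under eq_bigr => k _ do rewrite (expectE _ _ (L2g k) (avG k)).
under [X in (_ + _ * X)%E]eq_bigr => k _ do rewrite (expectE _ _ (L2df k) (avX k)).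
rewrite !sumEFin -[X in (X + _)%E]EFinM -[X in (_ + X)%E]EFinM -EFinD -EFinM lee_fin.
have r0 : 0 <= r := rho_ge0 W.
have -> : f 0 = f x0 by rewrite x0_0.
have -> : 1 - r = 1 - Num.sqrt r ^+ 2 by rewrite sqr_sqrtr.
apply: (rate_arithmetic n_gt0 K_ge1 gamma_gt0 L_ge0 (sqrtr_ge0 r)
  (sqrt_rho_lt1 gap) D2_gt0 (sqr_ge0 sigma) (sqr_ge0 varsigma) _
  (S := \sum_(k < K) \int[P]_w disagreement F W gamma x0 xi k w)).
- by apply: sumr_ge0 => k _; apply: Rintegral_ge0 => w _; exact: dot_ge0.
- by apply: sumr_ge0 => k _; apply: Rintegral_ge0 => w _; exact: spread_ge0.
- exact: (expected_descent _ F_diff F_int unb xi_law xi_indep L_ge0 f_lip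
    sigma_b n_gt0 gamma_gt0 W_sym W_stoch f_lb).
- exact: (expected_spread_sum _ _ F_diff F_int unb xi_law xi_indep L_ge0 f_lip
    sigma_b n_gt0 W_sym W_stoch gap varsigma_b).
Qed.
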